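(* Let $n>k\ge1$, let $F:(\mathbb{C}^n,0)\to(\mathbb{C}^k,0)$ be a complex Hamm map, $G$ the associated mixed Hamm map, and $G_t=(1-t)G+tF$. For each fixed $r>0$ and $0\le t\le1$ the following hold. (1) There exists a diffeomorphism of pairs $\psi_t:(\mathbb{S}^{2n-1}_r,K_{G_t})\to(\mathbb{S}^{2n-1}_r,K_F)$. (2) For every $I\subset\{1,\dots,n\}$ with $|I|>k$, the map $\psi_t$ also restricts to a diffeomorphism of pairs $\psi_t^I:(\mathbb{S}^{2|I|-1}_r,K_{G_t^I})\to(\mathbb{S}^{2|I|-1}_r,K_{F^I})$.
   Context: Fix a vector $(a_1,\dots,a_n)$ of positive integers, a vector $(b_1,\dots,b_n)$ of non-negative integers, and complex numbers $\lambda_{ij}$, $1\le i\le k$, $1\le j\le n$, such that all $k\times k$ minors of the matrix $\Lambda=(\lambda_{ij})$ are nonzero. The complex Hamm map is $F=(f^1,\dots,f^k)$ with $f^i(z)=\sum_{j=1}^n\lambda_{ij}z_j^{a_j}$; the mixed Hamm map is $G=(g^1,\dots,g^k)$ with $g^i(z,\bar z)=\sum_{j=1}^n\lambda_{ij}z_j^{a_j+b_j}\bar z_j^{b_j}$. Here $\mathbb{S}^{2n-1}_r$ is the sphere of radius $r$ centred at $0\in\mathbb{C}^n$, and the links are $K_{G_t}=G_t^{-1}(0)\cap\mathbb{S}^{2n-1}_r$, $K_F=F^{-1}(0)\cap\mathbb{S}^{2n-1}_r$. For $I\subset\{1,\dots,n\}$, $\mathbb{C}^I=\{z: z_i=0\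 \forall i\notin I\}$, $\mathbb{S}^{2|I|-1}_r=\mathbb{S}^{2n-1}_r\cap\mathbb{C}^I$, $F^I=F|_{\mathbb{C}^I}$, $G_t^I=G_t|_{\mathbb{C}^I}$, and $K_{F^I},K_{G^I_t}$ are the zero sets of these restrictions in $\mathbb{S}^{2|I|-1}_r$. *)

(* Defs.v *)
From HB Require Import structures.
From mathcomp Require Import all_boot all_order all_algebra.
From mathcomp Require Import complex.
From mathcomp Require Import all_classical all_reals all_analysis.

Set Implicit Arguments.
Unset Strict Implicit.
Unset Printing Implicit Defensive.

Import Order.TTheory GRing.Theory Num.Theory.
Import numFieldNormedType.Exports.

Local Open Scope classical_set_scope.
Local Open Scope ring_scope.
Local Open Scope complex_scope.

Section Smoothness.
Context {R : realType}.

(* For [U] open and [V] finite-dimensional, continuity of all the maps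
   [x |-> 'd f x v] amounts to continuity of [x |-> 'd f x]. *)
Fixpoint class_C {V W : normedModType R} (m : nat) (U : set V) (f : V -> W)
    : Prop :=
  match m with
  | 0%N => forall x, U x -> {for x, continuous f}
  | m'.+1 => (forall x, U x -> differentiable f x) /\
             (forall v, class_C m' U (fun x => 'd f x v))
  end.

Definition class_Coo {V W : normedModType R} (U : set V) (f : V -> W) : Prop :=
  forall m, class_C m U f.

(* The identification of C^n with R^(2n), z |-> (Re z, Im z); smoothness is
   real smoothness, whereas the normed module structure that matrices over
   [R[i]] inherit is over the scalars [R[i]]. *)
Definition realify {n : nat} (z : 'rV[R[i]]_n) : 'rV[R]_(n + n) :=
  row_mx (map_mx (@complex.Re R) z) (map_mx (@complex.Im R) z).

Definition complexify {n : nat} (x : 'rV[R]_(n + n)) : 'rV[R[i]]_n :=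
  \row_j (lsubmx x ord0 j +i* rsubmx x ord0 j).

Lemma realifyK n : cancel (@realify n) complexify.
Proof.
move=> z; apply/rowP => j.
by rewrite mxE row_mxKl row_mxKr !mxE; case: (z ord0 j).
Qed.

Lemma complexifyK n : cancel (@complexify n) realify.
Proof.
move=> x; rewrite -[RHS]hsubmxK; congr row_mx; apply/rowP => j;
by rewrite !mxE.
Qed.

(* Smoothness of a map defined on an arbitrary subset of a Euclidean space:
   near each point of the subset it extends to a smooth map on an open set.
   For embedded submanifolds, such as spheres, this is the usual notion. *)
Definition smooth_on {n p : nat} (A : set 'rV[R[i]]_n)
    (f : 'rV[R[i]]_n -> 'rV[R[i]]_p) : Prop :=
  forall z, A z ->
    exists (U : set 'rV[R]_(n + n)) (g : 'rV[R]_(n + n) -> 'rV[R]_(p + p)),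
      [/\ open U, U (realify z), class_Coo U g &
          forall w, A w -> U (realify w) -> g (realify w) = realify (f w)].

(* [f] is a total function of which only the values on [A] matter. *)
Definition diffeomorphism {n p : nat} (A : set 'rV[R[i]]_n)
    (B : set 'rV[R[i]]_p) (f : 'rV[R[i]]_n -> 'rV[R[i]]_p) : Prop :=
  smooth_on A f /\
  exists g : 'rV[R[i]]_p -> 'rV[R[i]]_n,
    [/\ smooth_on B g,
        forall z, A z -> B (f z), forall w, B w -> A (g w),
        {in A, cancel f g} & {in B, cancel g f}].

Definition diffeomorphism_of_pairs {n p : nat}
    (A K : set 'rV[R[i]]_n) (B L : set 'rV[R[i]]_p)
    (f : 'rV[R[i]]_n -> 'rV[R[i]]_p) : Prop :=
  diffeomorphism A B f /\ f @` K = L.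

End Smoothness.

Section HammMaps.
Context {R : realType} {n k : nat}.
Implicit Types (a b : 'I_n -> nat) (Lam : 'M[R[i]]_(k, n)).
Implicit Types (H : 'rV[R[i]]_n -> 'rV[R[i]]_k) (I : {set 'I_n}).

Definition all_maximal_minors_nonzero Lam : Prop :=
  forall s : 'I_k -> 'I_n, {homo s : i j / (i < j)%N} ->
    \det (colsub s Lam) != 0.

Definition hamm Lam a (z : 'rV[R[i]]_n) : 'rV[R[i]]_k :=
  \row_(i < k) \sum_(j < n) Lam i j * z ord0 j ^+ a j.

Definition mixed_hamm Lam a b (z : 'rV[R[i]]_n) : 'rV[R[i]]_k :=
  \row_(i < k) \sum_(j < n)
    Lam i j * z ord0 j ^+ (a j + b j) * (z ord0 j)^* ^+ b j.

Definition hamm_deformation Lam a b (t : R) (z : 'rV[R[i]]_n)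
    : 'rV[R[i]]_k :=
  (1 - t)%:C *: mixed_hamm Lam a b z + t%:C *: hamm Lam a z.

Definition sphere (r : R) : set 'rV[R[i]]_n :=
  [set z | \sum_(j < n) `|z ord0 j| ^+ 2 = (r ^+ 2)%:C].

Definition coord_subspace I : set 'rV[R[i]]_n :=
  [set z | forall j, j \notin I -> z ord0 j = 0].

Definition coord_sphere (r : R) I : set 'rV[R[i]]_n :=
  sphere r `&` coord_subspace I.

Definition link (r : R) H : set 'rV[R[i]]_n :=
  H @^-1` [set 0] `&` sphere r.

(* The zero set, in the sphere of C^I, of the restriction of [H] to C^I. *)
Definition coord_link (r : R) I H : set 'rV[R[i]]_n :=
  H @^-1` [set 0] `&` coord_sphere r I.

End HammMaps.

(* Main.v *)
Require Import Defs.
From HB Require Import structures.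
From mathcomp Require Import all_boot all_order all_algebra.
From mathcomp Require Import complex.
From mathcomp Require Import all_classical all_reals all_analysis.
From mathcomp Require Import ring lra.

(** Write the deformation as G_t(z)_i = sum_j Lam i j z_j^(a_j) rho_j(|z_j|^2) with
    rho_j(y) = (1 - t) y^(b_j) + t.

    For t > 0 the functions rho_j are positive, and w_j = z_j rho_j(|z_j|^2)^(1/a_j)
    is a radial diffeomorphism of each coordinate line which carries G_t to F. Since
    F is weighted homogeneous, w can be moved back to the sphere along the
    weighted action of the positive reals without leaving the zero set. The inverse
    is of the same kind, with the roles of the weights exchanged; both maps are
    smooth by the implicit function theorem for monotone equations
    ([smooth_monotone_implicit], [radial_projection], [weighted_hamm_equiv]). They
    multiply each coordinate by a nonzero number, so that they preserve all
    coordinate spheres.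

    At t = 0 the functions rho_j vanish at 0 if b_j > 0, and this map is not smooth
    in both directions. Here G_0 is compared with G_e for one small e > 0.
    The map G_0 is linear in the monomials u_j = z_j^(a_j) |z_j|^(2 b_j), and
    G_e = G_0 + e C with C smooth. Adding to u a right inverse of Lam applied to e C
    turns the zeros of G_e into zeros of G_0. The right inverse is an average over
    the maximal minors of Lam, the minor on the columns s being weighted by the product
    of the |u_j|^2 for j in s. This makes the correction of u_j divisible by u_j, so that
    it is achieved by a smooth multiplier of z_j close to 1 ([mixed_root]). The weights
    do not all vanish at a zero of G_0 on the sphere, because the minors are nonzero: a
    nonzero kernel vector of Lam has at least k nonzero entries ([kernel_support]).
    Adding |G_e|^2 to the sum of the weights keeps the formula smooth on the
    whole sphere and changes G_0 of the corrected point only by a term of second order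
    in G_e, which for small e creates no new zeros ([corrected_zero]).

    The corrected point, projected to the sphere along the weighted action that
    belongs to G_0, depends smoothly on e and z and is z for e = 0. A smooth
    family of self-maps of the sphere that starts at the identity consists of
    diffeomorphisms for small e ([sphere_perturbation]): the homogeneous extension to the
    vector space is a small Lipschitz perturbation of the identity, hence bijective,
    and its inverse is smooth because its derivative is invertible ([smooth_inverse]).
    Composing the two comparisons settles t = 0. *)

Set Implicit Arguments.
Unset Strict Implicit.
Unset Printing Implicit Defensive.

Import Order.TTheory GRing.Theory Num.Theory.
Import numFieldNormedType.Exports.

Local Open Scope classical_set_scope.
Local Open Scope ring_scope.
Local Open Scope complex_scope.

(** * Differentials and maps of class C^m *)

Section Calculus.
Context {R : realType}.
Implicit Types V W Z : normedModType R.

Lemma diff_approx V W (f : V -> W) x : differentiable f x ->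
  forall e, 0 < e -> \forall y \near x, `|f y - f x - 'd f x (y - x)| <= e * `|y - x|.
Proof.
move=> df e e0; have /diff_locally/eqaddoP/(_ e e0) H := df.
rewrite (near_shift 0) /=; near=> h; rewrite /= subr0 addrK.
suff : `|(f \o shift x - (cst (f x) + 'd f x)) h| <= e * `|id h|.
  by rewrite /= opprD addrA.
by near: h.
Unshelve. all: by end_near. Qed.

Lemma is_diff_approx V W (f L : V -> W) x : linear L -> continuous L ->
  (forall e, 0 < e -> \forall y \near x, `|f y - f x - L (y - x)| <= e * `|y - x|) ->
  is_diff x f L.
Proof.
move=> linL cL0 H.
pose LM := GRing.isLinear.Build _ _ _ _ _ linL.
pose L' : {linear _ -> _} := HB.pack L LM.
have cL : continuous L' by [].
have LE : L = L' by [].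
have fo : f \o shift x = cst (f x) + L +o_ 0 id.
  apply/eqaddoP => e e0; move: (H _ e0); rewrite (near_shift 0) /= => {}H.
  near=> h.
  have : ((fun y => `|f y - f x - L (y - x)| <= e * `|y - x|) \o shift (x - 0)) h.
    by near: h.
  by rewrite /= subr0 addrK opprD addrA.
rewrite LE in fo; have dE := diff_unique cL fo.
by apply: DiffDef => //; apply/diff_locallyP; rewrite dE.
Unshelve. all: by end_near. Qed.

Lemma near_is_diff V W (f g : V -> W) x : (\forall y \near x, f y = g y) ->
  differentiable f x -> is_diff x g ('d f x).
Proof.
move=> fg df; apply: is_diff_approx; [exact: linearP|exact: diff_continuous|].
move=> e e0; have fgx := nbhs_singleton fg.
have := diff_approx df e0; apply: filterS2 fg => y <-.
by rewrite -fgx.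
Qed.

Lemma class_CS V W m U (f : V -> W) : class_C m.+1 U f -> class_C m U f.
Proof.
elim: m f => [|m IH] f /= [df cf].
  by move=> x Ux; apply/differentiable_continuous/df.
by split=> // v; apply: IH; apply: cf.
Qed.

Lemma class_C_continuous V W m U (f : V -> W) :
  class_C m U f -> forall x, U x -> {for x, continuous f}.
Proof. by elim: m => // m IH /class_CS. Qed.

Lemma class_C_sub V W m (U U' : set V) (f : V -> W) :
  U' `<=` U -> class_C m U f -> class_C m U' f.
Proof.
move=> UU; elim: m f => [|m IH] f /=; first by move=> H x /UU; apply: H.
by move=> [df cf]; split=> [x /UU|v]; [apply: df|apply/IH/cf].
Qed.

Lemma class_C_ext V W m (U : set V) (f g : V -> W) : open U ->
  (forall x, U x -> f x = g x) -> class_C m U f -> class_C m U g.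
Proof.
move=> oU; elim: m f g => [|m IH] f g fg /=.
  move=> cf x Ux; have nU : \forall y \near x, f y = g y.
    by have := open_nbhs_nbhs (conj oU Ux); apply: filterS => y /fg.
  rewrite /prop_for /continuous_at -(fg _ Ux); apply: cvg_trans (cf x Ux).
  by apply: near_eq_cvg; apply: filterS nU => y ->.
move=> [df cf].
have dg x : U x -> is_diff x g ('d f x).
  move=> Ux; apply: near_is_diff (df x Ux).
  by have := open_nbhs_nbhs (conj oU Ux); apply: filterS => y /fg.
split=> [x /dg //|v]; apply: IH (cf v) => x /dg dgx.
by rewrite [in RHS]diff_val.
Qed.

(** Smoothness is always proved by induction on the order: a formula for the
    derivative, in which only maps of the previous order occur, is enough. *)
Lemma class_C_step V W m (U : set V) (f : V -> W) (df : V -> V -> W) : open U ->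
  (forall x, U x -> is_diff x f (df x)) ->
  (forall v, class_C m U (fun x => df x v)) -> class_C m.+1 U f.
Proof.
move=> oU dfE cdf; split=> [x /dfE //|v].
by apply: class_C_ext (cdf v) => // x /dfE dfx; rewrite [in RHS]diff_val.
Qed.

Lemma class_C_cst V W m (U : set V) (c : W) : class_C m U (cst c).
Proof.
elim: m c => [|m IH] c /=; first by move=> x _; exact: cst_continuous.
split=> [x _|v]; first exact: differentiable_cst.
rewrite (_ : (fun _ => _) = cst 0); first exact: IH.
by apply/funext => x; rewrite diff_cst.
Qed.

Lemma class_C_linear V W m (U : set V) (f : V -> W) :
  (forall x, is_diff x f f) -> class_C m U f.
Proof.
move=> df; case: m => [|m] /=.
  by move=> x _; apply: differentiable_continuous.
split=> [x _ //|v]; rewrite (_ : (fun _ => _) = cst (f v)); first exact: class_C_cst.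
by apply/funext => x; rewrite diff_val.
Qed.

Lemma class_CD V W m (U : set V) (f g : V -> W) : open U ->
  class_C m U f -> class_C m U g -> class_C m U (fun x => f x + g x).
Proof.
move=> oU; elim: m f g => [|m IH] f g.
  by move=> cf cg x Ux; apply: continuousD; [exact: cf|exact: cg].
move=> [df cf] [dg cg].
apply: (class_C_step (df := fun x v => 'd f x v + 'd g x v)) => //.
  move=> x Ux; have /differentiableP dfx := df x Ux.
  have /differentiableP dgx := dg x Ux.
  exact: (is_diffD dfx dgx).
by move=> v; apply: (IH (fun x => 'd f x v) (fun x => 'd g x v) (cf v) (cg v)).
Qed.

Lemma class_CM V m (U : set V) (f g : V -> R) : open U ->
  class_C m U f -> class_C m U g -> class_C m U (fun x => f x * g x).
Proof.
move=> oU; elim: m f g => [|m IH] f g.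
  by move=> cf cg x Ux; apply: continuousM; [exact: cf|exact: cg].
move=> cf' cg'; have [df cf] := cf'; have [dg cg] := cg'.
apply: (class_C_step (df := fun x v => f x * 'd g x v + g x * 'd f x v)) => //.
  move=> x Ux; have /differentiableP dfx := df x Ux.
  have /differentiableP dgx := dg x Ux.
  exact: (is_diffM dfx dgx).
move=> v; apply: class_CD => //.
  exact: (IH f (fun x => 'd g x v) (class_CS cf') (cg v)).
exact: (IH g (fun x => 'd f x v) (class_CS cg') (cf v)).
Qed.

Lemma class_C_lincomp V W Z m (U : set V) (f : V -> W) (l : W -> Z) : open U ->
  (forall y, is_diff y l l) -> class_C m U f -> class_C m U (l \o f).
Proof.
move=> oU dl; elim: m f => [|m IH] f.
  move=> cf x Ux; apply: continuous_comp; first exact: cf.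
  exact: differentiable_continuous.
move=> [df cf]; apply: (class_C_step (df := fun x v => l ('d f x v))) => //.
  move=> x Ux; have /differentiableP dfx := df x Ux.
  exact: is_diff_comp.
by move=> v; apply: (IH (fun x => 'd f x v) (cf v)).
Qed.

Lemma class_C_sum V W m (U : set V) (I : Type) (r : seq I) (P : pred I)
    (f : I -> V -> W) : open U -> (forall i, P i -> class_C m U (f i)) ->
  class_C m U (fun x => \sum_(i <- r | P i) f i x).
Proof.
move=> oU cf; elim: r => [|i r IH].
  by under eq_fun do rewrite big_nil; exact: class_C_cst.
under eq_fun do rewrite big_cons.
by case: (boolP (P i)) => // /cf ?; exact: class_CD.
Qed.

(** A finite-dimensional space enters the calculus only through a basis with
    continuous coordinates: it turns the derivative of a composite into a sum of
    products, to which induction on the order applies. *)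
Definition finite_basis W :=
  exists (N : nat) (e : 'I_N -> W) (l : 'I_N -> W -> R),
    (forall i y, is_diff y (l i) (l i)) /\
    (forall y, y = \sum_i l i y *: e i).

Lemma class_C_comp_real V W m (U : set V) (U' : set W) (f : V -> W) (g : W -> R) :
  finite_basis W -> open U -> (forall x, U x -> U' (f x)) ->
  class_C m U f -> class_C m U' g -> class_C m U (g \o f).
Proof.
move=> [N [e [l [dl eE]]]] oU UU'; elim: m g => [|m IH] g.
  move=> cf cg x Ux; apply: continuous_comp; first exact: cf.
  by apply: cg; apply: UU'.
move=> cf' [dg cg]; have [df cf] := cf'.
apply: (class_C_step (df := fun x v => \sum_i l i ('d f x v) * 'd g (f x) (e i))) => //.
  move=> x Ux; have /differentiableP dfx := df x Ux.
  have /differentiableP dgx := dg _ (UU' _ Ux).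
  have -> : (fun v => \sum_i l i ('d f x v) * 'd g (f x) (e i)) =
            'd g (f x) \o 'd f x.
    apply/funext => v /=; rewrite [in RHS](eE ('d f x v)) linear_sum.
    by apply: eq_bigr => i _; rewrite linearZ.
  exact: is_diff_comp.
move=> v; apply: class_C_sum => // i _; apply: class_CM => //.
  exact: (class_C_lincomp (f := fun x => 'd f x v) oU (dl i) (cf v)).
exact: (IH (fun y => 'd g y (e i)) (class_CS cf') (cg (e i))).
Qed.

Lemma is_diff_scaleDl W (e : W) (t : R) : is_diff t (fun s : R => s *: e) (fun s : R => s *: e).
Proof. exact: is_diff_scalel. Qed.

Lemma class_C_coord V W m (U : set V) (f : V -> W) N (e : 'I_N -> W) (l : 'I_N -> W -> R) :
  open U -> (forall y, y = \sum_i l i y *: e i) ->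
  (forall i, class_C m U (l i \o f)) -> class_C m U f.
Proof.
move=> oU eE cf; apply: (class_C_ext (f := fun x => \sum_i l i (f x) *: e i)) => //.
apply: class_C_sum => // i _.
exact: (@class_C_lincomp V R W m U (l i \o f) (fun s : R => s *: e i) oU
  (is_diff_scaleDl (e i)) (cf i)).
Qed.

Lemma class_C_comp V W Z m (U : set V) (U' : set W) (f : V -> W) (g : W -> Z) :
  finite_basis W -> finite_basis Z -> open U -> open U' ->
  (forall x, U x -> U' (f x)) ->
  class_C m U f -> class_C m U' g -> class_C m U (g \o f).
Proof.
move=> bW [N [e [l [dl eE]]]] oU oU' UU' cf cg.
apply: (class_C_coord (e := e) (l := l)) => // i.
exact: (@class_C_comp_real V W m U U' f (l i \o g) bW oU UU' cf
  (class_C_lincomp oU' (dl i) cg)).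
Qed.

Lemma finite_basis_real : finite_basis R.
Proof.
exists 1%N, (fun=> 1), (fun _ x => x); split => [_ y|y]; first exact: is_diff_id.
by rewrite big_ord1 [RHS]mulr1.
Qed.

Lemma is_diff_coord N (i : 'I_N) (y : 'rV[R]_N) :
  is_diff y (fun x : 'rV[R]_N => x 0 i) (fun x : 'rV[R]_N => x 0 i).
Proof.
have @f : {linear 'rV[R]_N -> R}.
  by exists (fun x : 'rV[R]_N => x 0 i); do 2![eexists]; do ?[constructor];
     rewrite ?mxE// => ? *; rewrite ?mxE//; move=> ?; rewrite !mxE.
have cf : continuous f by exact: coord_continuous.
rewrite (_ : (fun _ => _) = f) //; apply: DiffDef; last exact: diff_lin.
exact: linear_differentiable.
Qed.

Lemma finite_basis_rV N : finite_basis 'rV[R]_N.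
Proof.
exists N, (fun i => delta_mx 0 i), (fun i (x : 'rV[R]_N) => x 0 i); split.
  by move=> i y; exact: is_diff_coord.
exact: row_sum_delta.
Qed.

Lemma is_diff_fst V W (p : V * W) : is_diff p (@fst V W) (@fst V W).
Proof.
have @f : {linear (V * W)%type -> V} by exists (@fst V W); do 2![eexists]; do ?[constructor].
have cf : continuous f by move=> ?; exact: cvg_fst.
rewrite (_ : fst = f) //; apply: DiffDef; last exact: diff_lin.
exact: linear_differentiable.
Qed.

Lemma is_diff_snd V W (p : V * W) : is_diff p (@snd V W) (@snd V W).
Proof.
have @f : {linear (V * W)%type -> W} by exists (@snd V W); do 2![eexists]; do ?[constructor].
have cf : continuous f by move=> ?; exact: cvg_snd.
rewrite (_ : snd = f) //; apply: DiffDef; last exact: diff_lin.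
exact: linear_differentiable.
Qed.

Lemma finite_basis_prod V W : finite_basis V -> finite_basis W -> finite_basis (V * W)%type.
Proof.
move=> [N [e [l [dl eE]]]] [N' [e' [l' [dl' eE']]]].
exists (N + N')%N,
  (fun i => match fintype.split i with inl j => (e j, 0) | inr j => (0, e' j) end),
  (fun i p => match fintype.split i with inl j => l j p.1 | inr j => l' j p.2 end).
split=> [i y|[y z]].
  case: (fintype.split i) => j.
    exact: (is_diff_comp (is_diff_fst y) (dl j _)).
  exact: (is_diff_comp (is_diff_snd y) (dl' j _)).
rewrite big_split_ord /=.
under eq_bigr do rewrite (unsplitK (inl _)).
under [X in _ + X]eq_bigr do rewrite (unsplitK (inr _)).
rewrite {1}(eE y) {1}(eE' z); apply: injective_projections => /=.
  rewrite !raddf_sum /= [X in _ + X]big1 ?addr0// => i _.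
  by rewrite scaler0.
rewrite !raddf_sum /= [X in X + _]big1 ?add0r// => i _.
by rewrite scaler0.
Qed.

Lemma open_preimage (V W : normedModType R) (D : set V) (U : set W) (f : V -> W) :
  open D -> open U -> (forall u, D u -> {for u, continuous f}) ->
  open (D `&` f @^-1` U).
Proof.
move=> oD oU cf; rewrite openE => x [Dx fx]; apply: filterI; first exact: open_nbhs_nbhs.
by have /(_ U) := cf x Dx; apply; exact: open_nbhs_nbhs.
Qed.

End Calculus.

(** * Elementary functions *)

Section MoreCalculus.
Context {R : realType}.
Implicit Types V W Z : normedModType R.

Lemma is_diff_derive1 (f : R -> R) (x c : R) : is_derive x 1 f c ->
  is_diff x f (fun v => v * c).
Proof.
move=> [df fc]; have dfx : differentiable f x by exact/derivable1_diffP.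
apply: DiffDef => //; apply/funext => v.
by rewrite deriv1E // derive1E fc.
Qed.

Lemma class_C_derive1 m (U : set R) (f f' : R -> R) : open U ->
  (forall x : R, U x -> is_derive x 1 f (f' x)) -> class_C m U f' ->
  class_C m.+1 U f.
Proof.
move=> oU df cf'; apply: (@class_C_step _ _ _ m U f (fun x v : R => v * f' x)) => //.
  by move=> x /df /is_diff_derive1.
by move=> v; apply: class_CM => //; exact: class_C_cst.
Qed.

Lemma class_CN V m (U : set V) (f : V -> R) : open U ->
  class_C m U f -> class_C m U (fun x => - f x).
Proof.
move=> oU cf; apply: (class_C_ext (f := fun x => -1 * f x)) => //.
  by move=> x _; rewrite mulN1r.
by apply: class_CM => //; exact: class_C_cst.
Qed.

Lemma class_CB V m (U : set V) (f g : V -> R) : open U ->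
  class_C m U f -> class_C m U g -> class_C m U (fun x => f x - g x).
Proof. by move=> oU cf cg; apply: class_CD => //; exact: class_CN. Qed.

Lemma class_C_prod V m (U : set V) (I : Type) (r : seq I) (P : pred I)
    (f : I -> V -> R) : open U -> (forall i, P i -> class_C m U (f i)) ->
  class_C m U (fun x => \prod_(i <- r | P i) f i x).
Proof.
move=> oU cf; elim: r => [|i r IH].
  by under eq_fun do rewrite big_nil; exact: class_C_cst.
under eq_fun do rewrite big_cons.
by case: (boolP (P i)) => // /cf ?; exact: class_CM.
Qed.

Lemma class_C_id V m (U : set V) : class_C m U (fun x : V => x).
Proof. by apply: class_C_linear => x; exact: is_diff_id. Qed.

Lemma class_CX V m (U : set V) (f : V -> R) k : open U ->
  class_C m U f -> class_C m U (fun x => f x ^+ k).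
Proof.
move=> oU cf; elim: k => [|k IH].
  by under eq_fun do rewrite expr0; exact: class_C_cst.
by under eq_fun do rewrite exprS; exact: class_CM.
Qed.

Lemma open_neq0 : open [set x : R | x != 0].
Proof.
rewrite (_ : [set _ | _] = ~` [set 0]); last first.
  by apply/seteqP; split=> x /= /eqP.
by rewrite openC; exact: closed_eq.
Qed.

Lemma class_C_Rinv m : class_C m [set x : R | x != 0] GRing.inv.
Proof.
elim: m => [|m IH]; first by move=> x x0; exact: inv_continuous.
apply: (@class_C_step _ _ _ m _ _ (fun x h : R => - (x^-1 * x^-1) * h)); first exact: open_neq0.
  move=> x x0; apply: DiffDef; first exact: differentiable_Rinv.
  by rewrite diff_Rinv//; apply/funext => h; rewrite /= expr2 invfM.
move=> v; apply: class_CM; [exact: open_neq0| |exact: class_C_cst].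
apply: class_CN; first exact: open_neq0.
by apply: class_CM => //; exact: open_neq0.
Qed.

Lemma class_C_expR m (U : set R) : open U -> class_C m U expR.
Proof.
move=> oU; elim: m => [|m IH]; first by move=> x _; exact: continuous_expR.
by apply: (class_C_derive1 (f' := expR)).
Qed.

Lemma class_C_sin_cos m (U : set R) : open U -> class_C m U sin /\ class_C m U cos.
Proof.
move=> oU; elim: m => [|m [IHs IHc]].
  by split=> x _; [exact: continuous_sin|exact: continuous_cos].
split; first by apply: (class_C_derive1 (f' := cos)).
by apply: (class_C_derive1 (f' := fun x => - sin x)) => //; exact: class_CN.
Qed.

Lemma class_C_comp_function V m (U : set V) (U' : set R) (f : V -> R) (h : R -> R) :
  open U -> (forall x, U x -> U' (f x)) ->
  class_C m U f -> class_C m U' h -> class_C m U (fun x => h (f x)).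
Proof. by move=> *; apply: (class_C_comp_real (U' := U')) => //; exact: finite_basis_real. Qed.

Lemma class_CV V m (U : set V) (f : V -> R) : open U ->
  (forall x, U x -> f x != 0) -> class_C m U f -> class_C m U (fun x => (f x)^-1).
Proof. by move=> oU f0 cf; apply: class_C_comp_function (class_C_Rinv m). Qed.

Lemma class_C_ln m : class_C m [set x : R | 0 < x] (@ln R).
Proof.
elim: m => [|m IH]; first by move=> x x0; exact: continuous_ln.
apply: (class_C_derive1 (f' := fun x => x^-1)); first exact: open_gt.
apply: (class_C_sub _ (class_C_Rinv m)) => x /=; exact: lt0r_neq0.
Qed.

Lemma class_C_atan m (U : set R) : open U -> class_C m U atan.
Proof.
move=> oU; elim: m => [|m IH]; first by move=> x _; exact: continuous_atan.
apply: (class_C_derive1 (f' := fun x => (1 + x ^+ 2)^-1)) => //.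
apply: class_CV => //.
  by move=> x _; rewrite gt_eqF// ltr_pwDl// sqr_ge0.
apply: class_CD => //; first exact: class_C_cst.
exact: (@class_CX _ m U id 2 oU (class_C_id m U)).
Qed.

Lemma class_C_sqrt m : class_C m [set x : R | 0 < x] Num.sqrt.
Proof.
apply: (class_C_ext (f := fun x => expR (ln x / 2))); first exact: open_gt.
  move=> x x0; apply/eqP; rewrite -(@eqrXn2 _ 2)// ?expR_ge0//.
  rewrite sqr_sqrtr ?(ltW x0)// -expRM_natl -mulr_natl mulrC divfK// lnK//.
apply: (@class_C_comp_function _ m _ setT (fun x => ln x / 2) expR) => //.
- by apply: class_CM; [exact: open_gt|exact: class_C_ln|exact: class_C_cst].
- exact: class_C_expR openT.
Qed.

End MoreCalculus.

(** * Inverse and implicit functions *)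

Section InverseFunctions.
Context {R : realType}.
Implicit Types V W Z : normedModType R.

Lemma lipschitz_continuous V W (f : V -> W) (k : R) :
  (forall x y, `|f x - f y| <= k * `|x - y|) -> continuous f.
Proof.
move=> lf x; apply/cvgrPdist_le => e e0.
have k0 : 0 < `|k| + 1 by rewrite ltr_wpDl.
near=> y; apply: (le_trans (lf _ _)); apply: (@le_trans _ _ ((`|k| + 1) * `|x - y|)).
  by apply: ler_wpM2r => //; rewrite (le_trans (ler_norm k))// lerDl.
rewrite -ler_pdivlMl// mulrC.
by near: y; apply: cvgr_dist_le => //; rewrite divr_gt0.
Unshelve. all: by end_near. Qed.

(** If f \o p = i near z with i linear, then p is differentiable as soon as the
    derivative of f at [p z] has a left inverse: the distance of v to [p z] is then
    at most a multiple of that of [f v] to [f (p z)], so that the error of the linear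
    approximation of f is small compared with the distance to z as well. *)
Lemma is_diff_left_inverse V W Z (f : V -> W) (p : Z -> V) (i : Z -> W)
    (B : W -> V) (k l : R) z :
  differentiable f (p z) -> {for z, continuous p} ->
  linear i -> (forall u, `|i u| <= l * `|u|) ->
  (\forall u \near z, f (p u) = i u) ->
  linear B -> (forall w, `|B w| <= k * `|w|) ->
  (forall v, B ('d f (p z) v) = v) -> is_diff z p (B \o i).
Proof.
move=> df cp li il fp lB Bk BA.
pose LM := GRing.isLinear.Build _ _ _ _ _ lB.
pose L : {linear _ -> _} := HB.pack B LM.
pose iM := GRing.isLinear.Build _ _ _ _ _ li.
pose I : {linear _ -> _} := HB.pack i iM.
have BE : B = L by []. have iE : i = I by [].
have lBi : linear (B \o i) by move=> a u v /=; rewrite li lB.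
have k0 : 0 < `|k| + 1 by rewrite ltr_wpDl.
have l0 : 0 < `|l| + 1 by rewrite ltr_wpDl.
have {}Bk w : `|B w| <= (`|k| + 1) * `|w|.
  apply: (le_trans (Bk _)); apply: ler_wpM2r => //.
  by rewrite (le_trans (ler_norm k))// lerDl.
have {}il w : `|i w| <= (`|l| + 1) * `|w|.
  apply: (le_trans (il _)); apply: ler_wpM2r => //.
  by rewrite (le_trans (ler_norm l))// lerDl.
set K := `|k| + 1 in k0 Bk. set M := `|l| + 1 in l0 il.
apply: is_diff_approx => //.
  apply: (@lipschitz_continuous _ _ _ (K * M)) => u v /=.
  by rewrite BE iE -!linearB -BE -iE (le_trans (Bk _))// -mulrA ler_wpM2l// ltW.
move=> e e0.
(* K d <= 1/2 absorbs the error into |x|; 2 K^2 M d <= e gives the estimate *)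
pose d := Num.min (2^-1 / K) (e / (2 * K ^+ 2 * M)).
have d0 : 0 < d.
  by rewrite lt_min !divr_gt0 ?invr_gt0 ?mulr_gt0 ?exprn_gt0.
have dK : K * d <= 2^-1.
  by rewrite mulrC -ler_pdivlMr// ge_min lexx.
have dKM : (K * d) * (2 * K * M) <= e.
  have -> : (K * d) * (2 * K * M) = d * (2 * K ^+ 2 * M) by ring.
  by rewrite -ler_pdivlMr ?mulr_gt0 ?exprn_gt0// ge_min lexx orbT.
have := cp _ (diff_approx df d0); rewrite /nbhs /= => {}cp.
have fpz := nbhs_singleton fp.
near=> y.
have : `|f (p y) - f (p z) - 'd f (p z) (p y - p z)| <= d * `|p y - p z| by near: y.
have -> : f (p y) = i y by near: y.
rewrite fpz; set x := p y - p z; set w := i y - i z => H.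
have H1 : `|B w - x| <= K * d * `|x|.
  rewrite -{1}(BA x) BE -linearB -BE -mulrA; apply: (le_trans (Bk _)).
  by rewrite ler_wpM2l// ltW.
have H2 : `|x| <= 2 * `|B w|.
  have : `|x| <= `|B w| + `|B w - x|.
    rewrite -{1}(subKr (B w) x); exact: ler_normB.
  have : K * d * `|x| <= 2^-1 * `|x| by apply: ler_wpM2r.
  have : 0 <= `|x| by []. lra.
have H3 : `|x| <= 2 * K * M * `|y - z|.
  apply: (le_trans H2); rewrite -!mulrA ler_pM2l//.
  apply: (le_trans (Bk _)); rewrite ler_pM2l//.
  by rewrite /w iE -linearB.
rewrite /= iE linearB -iE -/w distrC; apply: (le_trans H1).
apply: (le_trans (ler_wpM2l _ H3)); first by rewrite mulr_ge0 ?ltW.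
by rewrite mulrA; apply: ler_wpM2r.
Unshelve. all: by end_near. Qed.

End InverseFunctions.

Section SmoothInverse.
Context {R : realType}.
Implicit Types V W Z : normedModType R.

Lemma linear_rV_bound N W (B : 'rV[R]_N -> W) : linear B ->
  forall w, `|B w| <= (\sum_i `|B (delta_mx 0 i)|) * `|w|.
Proof.
move=> lB w.
pose LM := GRing.isLinear.Build _ _ _ _ _ lB.
pose L : {linear _ -> _} := HB.pack B LM.
have BE : B = L by [].
rewrite {1}[w]row_sum_delta BE linear_sum -BE mulr_suml.
apply: (le_trans (ler_norm_sum _ _ _)); apply: ler_sum => i _.
rewrite BE linearZ normrZ -BE mulrC ler_wpM2l// [leRHS]/Num.Def.normr/= mx_normrE.
exact: (le_bigmax _ (fun k => `|w k.1 k.2|) (0, i)).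
Qed.

Lemma class_C_det V m (U : set V) k (A : V -> 'M[R]_k) : open U ->
  (forall i j, class_C m U (fun x => A x i j)) -> class_C m U (fun x => \det (A x)).
Proof.
move=> oU cA; apply: class_C_sum => // s _.
apply: class_CM => //; first exact: class_C_cst.
by apply: class_C_prod.
Qed.

Lemma class_C_adjugate V m (U : set V) k (A : V -> 'M[R]_k) i j : open U ->
  (forall i j, class_C m U (fun x => A x i j)) -> class_C m U (fun x => (\adj (A x)) i j).
Proof.
move=> oU cA.
rewrite (_ : (fun _ => _) = fun x => (-1) ^+ (j + i) * \det (row' j (col' i (A x)))).
  apply: class_CM => //; first exact: class_C_cst.
  apply: class_C_det => // i' j'.
  rewrite (_ : (fun _ => _) = fun x => A x (lift j i') (lift i j')) //.
  by apply/funext => x; rewrite !mxE.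
by apply/funext => x; rewrite mxE.
Qed.

Lemma class_C_rV V m (U : set V) N (f : V -> 'rV[R]_N) : open U ->
  (forall i, class_C m U (fun x => f x 0 i)) -> class_C m U f.
Proof.
move=> oU cf.
exact: (@class_C_coord _ _ _ m U f N (fun i => delta_mx 0 i)
  (fun i (x : 'rV[R]_N) => x 0 i) oU (@row_sum_delta _ _) cf).
Qed.

Lemma class_C_entry V m (U : set V) N (f : V -> 'rV[R]_N) i : open U ->
  class_C m U f -> class_C m U (fun x => f x 0 i).
Proof.
move=> oU; exact: (@class_C_lincomp _ _ _ _ m U f (fun x : 'rV[R]_N => x 0 i) oU
  (is_diff_coord i)).
Qed.

Lemma class_C_pair V W Z m (U : set V) (f : V -> W) (g : V -> Z) : open U ->
  class_C m U f -> class_C m U g -> class_C m U (fun x => (f x, g x)).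
Proof.
move=> oU; elim: m f g => [|m IH] f g.
  by move=> cf cg x Ux; exact: (cvg_pair (cf _ Ux) (cg _ Ux)).
move=> [df cf] [dg cg].
apply: (@class_C_step _ _ _ m U (fun x => (f x, g x)) (fun x v => ('d f x v, 'd g x v))) => //.
  move=> x Ux; have /differentiableP dfx := df x Ux.
  have /differentiableP dgx := dg x Ux.
  exact: is_diff_pair.
by move=> v; exact: (IH (fun x => 'd f x v) (fun x => 'd g x v) (cf v) (cg v)).
Qed.

Lemma class_CZ (V : normedModType R) m (U : set V) N (f : V -> R) (g : V -> 'rV[R]_N) :
  open U -> class_C m U f -> class_C m U g -> class_C m U (fun u => f u *: g u).
Proof.
move=> oU cf cg; apply: class_C_rV => // i.
rewrite (_ : (fun _ => _) = fun u => f u * g u 0 i).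
  by apply: class_CM => //; exact: class_C_entry.
by apply/funext => u; rewrite mxE.
Qed.

(** Continuity of the inverse g replaces the local existence part of the inverse
    function theorem. The derivative of g is the inverse of the Jacobian matrix of
    f at g, which is rational in the derivatives of f composed with g: so g gains
    one order of smoothness at a time. *)
Theorem smooth_inverse N (U D : set 'rV[R]_N) (f g : 'rV[R]_N -> 'rV[R]_N) :
  open U -> open D -> class_Coo U f -> (forall y, D y -> U (g y)) ->
  (forall y, D y -> f (g y) = y) -> (forall y, D y -> {for y, continuous g}) ->
  (forall y v, D y -> 'd f (g y) v = 0 -> v = 0) -> class_Coo D g.
Proof.
move=> oU oD cf gU fg cg injf.
pose J x : 'M[R]_N := lin1_mx ('d f x).
have Ju y : D y -> J (g y) \in unitmx.
  move=> Dy; rewrite -row_free_unit; apply: inj_row_free => v.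
  by rewrite mul_rV_lin1; exact: injf.
have dg y : D y -> is_diff y g (fun v => v *m invmx (J (g y))).
  move=> Dy; pose B (v : 'rV[R]_N) := v *m invmx (J (g y)).
  have lB : linear B by move=> a u v; rewrite /B mulmxDl scalemxAl.
  have -> : (fun v => v *m invmx (J (g y))) = B \o id by [].
  apply: (@is_diff_left_inverse _ _ _ _ f g id B _ 1) => //.
  - by have [df _] := cf 1%N; apply/df/gU.
  - exact: cg.
  - by move=> u; rewrite mul1r.
  - by have := open_nbhs_nbhs (conj oD Dy); apply: filterS => z /fg.
  - exact: linear_rV_bound.
  - by move=> v; rewrite /B -mul_rV_lin1 mulmxK// Ju.
elim=> [|m IH]; first exact: cg.
apply: (@class_C_step _ _ _ m D g (fun y v => v *m invmx (J (g y)))) => // v.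
apply: (@class_C_ext _ _ _ m D
  (fun y => v *m ((\det (J (g y)))^-1 *: \adj (J (g y))))) => //.
  by move=> y Dy; rewrite /invmx Ju.
have cJ i j : class_C m D (fun y => J (g y) i j).
  rewrite (_ : (fun _ => _) = (fun x => 'd f x (delta_mx 0 i) 0 j) \o g); last first.
    by apply/funext => y; rewrite /= /J mxE.
  apply: (@class_C_comp_real _ _ _ m D U) => //; first exact: finite_basis_rV.
  by apply: class_C_entry => //; have [_] := cf m.+1; exact.
apply: class_C_rV => // j.
rewrite (_ : (fun _ => _) =
  fun y => \sum_i v 0 i * ((\det (J (g y)))^-1 * (\adj (J (g y))) i j)); last first.
  by apply/funext => y; rewrite mxE; apply: eq_bigr => i _; rewrite mxE.
apply: class_C_sum => // i _; apply: class_CM => //; first exact: class_C_cst.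
apply: class_CM => //; last exact: class_C_adjugate.
apply: class_CV => //; last exact: class_C_det.
by move=> y /Ju; rewrite unitmxE unitfE.
Qed.

(** The graph x |-> (s x, x) is a right inverse of q |-> (F q, q.2) over the points
    (0, x), to which [is_diff_left_inverse] applies. *)
Theorem smooth_implicit V (U : set (R * V)) (D : set V) (F : R * V -> R) (s : V -> R) :
  finite_basis V -> open U -> open D -> class_Coo U F ->
  (forall x, D x -> U (s x, x)) -> (forall x, D x -> F (s x, x) = 0) ->
  (forall x, D x -> {for x, continuous s}) ->
  (forall x, D x -> 'd F (s x, x) (1, 0) != 0) -> class_Coo D s.
Proof.
move=> bV oU oD cF sU Fs cs F0.
pose p x : R * V := (s x, x).
have dF x : D x -> differentiable F (p x).
  by move=> Dx; have [df _] := cF 1%N; apply/df/sU.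
have ds x : D x ->
    is_diff x s (fun v => - ('d F (p x) (1, 0))^-1 * 'd F (p x) (0, v)).
  move=> Dx; set a := 'd F (p x) (1, 0).
  pose f (q : R * V) : R * V := (F q, q.2).
  have /differentiableP dFx := dF _ Dx.
  have dfx : is_diff (p x) f (fun v => ('d F (p x) v, v.2)).
    exact: is_diff_pair dFx (is_diff_snd _).
  pose B (q : R * V) : R * V := (a^-1 * (q.1 - 'd F (p x) (0, q.2)), q.2).
  have l0 c u v : 'd F (p x) (0, c *: u + v) = c * 'd F (p x) (0, u) + 'd F (p x) (0, v).
    have -> : (0, c *: u + v) = c *: (0, u) + (0, v) :> R * V.
      by apply: injective_projections; rewrite /= ?scaler0 ?addr0.
    by rewrite linearP.
  have lB : linear B.
    move=> c u v; rewrite /B /= l0; apply: injective_projections => //=.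
    rewrite /GRing.scale /=; ring.
  have [k k0 dFk] : exists2 k, 0 < k & forall q, `|'d F (p x) q| <= k * `|q|.
    by apply: linear_lipschitz; exact: diff_continuous.
  have Bk q : `|B q| <= (`|a^-1| * (1 + k) + 1) * `|q|.
    have q1 : `|q.1| <= `|q| by rewrite prod_normE le_max lexx.
    have q2 : `|q.2| <= `|q| by rewrite prod_normE le_max lexx orbT.
    have q02 : `|(0, q.2) : R * V| <= `|q|.
      by rewrite prod_normE /= normr0 ge_max normr_ge0.
    have C0 : 0 <= `|a^-1| * (1 + k) * `|q| by rewrite mulr_ge0// mulr_ge0// addr_ge0// ltW.
    rewrite prod_normE /= ge_max mulrDl mul1r; apply/andP; split; last first.
      by rewrite (le_trans q2)// lerDr.
    rewrite -[leLHS]addr0 lerD// normrM -mulrA ler_wpM2l//.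
    rewrite (le_trans (ler_normB _ _))// mulrDl mul1r lerD//.
    by rewrite (le_trans (dFk _))// ler_pM2l.
  pose i (v : V) : R * V := (0, v).
  have dp : is_diff x p (B \o i).
    apply: (@is_diff_left_inverse _ _ _ _ f p i B _ 1 x _ _ _ _ _ lB Bk) => //.
    - exact: (cvg_pair (cs _ Dx) cvg_id).
    - by move=> c u v; rewrite /i; apply: injective_projections; rewrite /= ?scaler0 ?addr0.
    - by move=> u; rewrite mul1r /i prod_normE /= normr0 ge_max lexx normr_ge0.
    - have := open_nbhs_nbhs (conj oD Dx); apply: filterS => z Dz.
      by rewrite /f /i /= Fs.
    - move=> [c v]; rewrite diff_val /B /=.
      have -> : 'd F (p x) (c, v) = c * a + 'd F (p x) (0, v).
        have -> : (c, v) = c *: (1, 0) + (0, v) :> R * V.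
          by apply: injective_projections; rewrite /= ?scaler0 ?add0r ?addr0 ?[RHS]mulr1.
        by rewrite linearP.
      by rewrite addrK mulrC mulfK ?F0.
  have -> : (fun v => - a^-1 * 'd F (p x) (0, v)) = fst \o (B \o i).
    by apply/funext => v; rewrite /B /i /= sub0r mulrN mulNr.
  exact: is_diff_comp dp (is_diff_fst _).
have bRV : finite_basis (R * V)%type.
  by apply: finite_basis_prod => //; exact: finite_basis_real.
elim=> [|m IH]; first exact: cs.
apply: (@class_C_step _ _ _ m D s
  (fun x v => - ('d F (p x) (1, 0))^-1 * 'd F (p x) (0, v))) => // v.
have cp : class_C m D p.
  exact: class_C_pair oD IH (class_C_id _ _).
have cdF w : class_C m D (fun x => 'd F (p x) w).
  apply: (@class_C_comp_real _ _ _ m D U p (fun q => 'd F q w)) => //.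
  by have [_] := cF m.+1; exact.
by apply: class_CM => //; apply: class_CN => //; apply: class_CV.
Qed.

End SmoothInverse.

Section MonotoneImplicit.
Context {R : realType}.
Implicit Types V W Z : normedModType R.

Lemma class_C_fst V W Z m (U : set Z) (f : Z -> V * W) : open U ->
  class_C m U f -> class_C m U (fun x => (f x).1).
Proof.
move=> oU; exact: (@class_C_lincomp _ _ _ _ m U f fst oU (@is_diff_fst _ _ _)).
Qed.

Lemma class_C_snd V W Z m (U : set Z) (f : Z -> V * W) : open U ->
  class_C m U f -> class_C m U (fun x => (f x).2).
Proof.
move=> oU; exact: (@class_C_lincomp _ _ _ _ m U f snd oU (@is_diff_snd _ _ _)).
Qed.

Lemma open_pos_times V (D : set V) : open D -> open [set q : R * V | 0 < q.1 /\ D q.2].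
Proof.
move=> oD; rewrite (_ : [set _ | _] = fst @^-1` [set c | 0 < c] `&` snd @^-1` D) //.
apply: openI; apply: open_comp => // x _; [exact: cvg_fst|exact: cvg_snd].
Qed.

Lemma is_derive_partial V (F : R * V -> R) (c : R) (x : V) : differentiable F (c, x) ->
  is_derive c 1 (fun u => F (u, x)) ('d F (c, x) (1, 0)).
Proof.
move=> /differentiableP dF.
have di : is_diff c (fun u => (u, x)) (fun v : R => (v, 0) : R * V).
  exact: (is_diff_pair (is_diff_id c) (is_diff_cst x c)).
have [dfi ddE] : is_diff c (fun u => F (u, x)) (fun v => 'd F (c, x) (v, 0)).
  exact: (is_diff_comp di dF).
by apply: DeriveDef; [exact: diff_derivable|rewrite deriveE// ddE].
Qed.

Lemma diff_partial V (F : R * V -> R) (c : R) (x : V) d : differentiable F (c, x) ->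
  is_derive c 1 (fun u => F (u, x)) d -> 'd F (c, x) (1, 0) = d.
Proof. by move=> /is_derive_partial[_ <-] [_ <-]. Qed.

(** Monotonicity supplies the continuity of s: the signs of F at s x - d and s x + d
    persist when x moves, and trap the zero between these two values. *)
Theorem smooth_monotone_implicit V (D : set V) (F : R * V -> R) (s : V -> R) :
  finite_basis V -> open D -> class_Coo [set q : R * V | 0 < q.1 /\ D q.2] F ->
  (forall x, D x -> 0 < s x) -> (forall x, D x -> F (s x, x) = 0) ->
  (forall x (c d : R), D x -> 0 < c -> c < d -> F (c, x) < F (d, x)) ->
  (forall x (c : R), D x -> 0 < c -> 'd F (c, x) (1, 0) != 0) -> class_Coo D s.
Proof.
move=> bV oD cF s0 Fs mF dF.
have oU := open_pos_times oD.
have cFx x (c : R) : D x -> 0 < c -> {for x, continuous (fun y => F (c, y))}.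
  move=> Dx c0; apply: (@continuous_comp _ _ _ (fun y => (c, y)) F).
    exact: (cvg_pair (cvg_cst c) cvg_id).
  exact: (cF 0%N (c, x)).
apply: (smooth_implicit bV oU oD cF) => //; last first.
- by move=> x Dx; apply: dF => //; exact: s0.
- move=> x Dx; apply/cvgrPdist_lt => e e0; rewrite near_map.
  pose d := Num.min (e / 2) (s x / 2).
  have sx0 := s0 x Dx.
  have d0 : 0 < d by rewrite lt_min !divr_gt0.
  have de : d < e by rewrite gt_min ltr_pdivrMr// ltr_pMr// ltr1n.
  have ds : 0 < s x - d.
    by rewrite subr_gt0 gt_min; apply/orP; right; rewrite ltr_pdivrMr// ltr_pMr// ltr1n.
  have ds' : 0 < s x + d by rewrite addr_gt0.
  have lo : F (s x - d, x) < 0 by rewrite -(Fs x Dx) mF// gtrBl.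
  have hi : 0 < F (s x + d, x) by rewrite -(Fs x Dx) mF// ltrDl.
  near=> y.
  have Dy : D y by near: y; exact: open_nbhs_nbhs.
  have ly : F (s x - d, y) < 0 by near: y; exact: (cvgr_lt _ (cFx _ _ Dx ds) _ lo).
  have hy : 0 < F (s x + d, y) by near: y; exact: (cvgr_gt _ (cFx _ _ Dx ds') _ hi).
  have : s y < s x + d.
    rewrite ltNge; apply/negP; rewrite le_eqVlt => /orP[/eqP E|lt].
      by move: hy; rewrite /= E Fs ?ltxx.
    by have := mF y _ _ Dy ds' lt; rewrite Fs// => /(lt_trans hy); rewrite ltxx.
  have : s x - d < s y.
    rewrite ltNge; apply/negP; rewrite le_eqVlt => /orP[/eqP E|lt].
      by move: ly; rewrite /= -E Fs ?ltxx.
    by have := mF y _ _ Dy (s0 _ Dy) lt; rewrite Fs// => /lt_trans/(_ ly); rewrite ltxx.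
  move=> *; rewrite ltr_norml; apply/andP; split; lra.
- by move=> x Dx; split=> //=; exact: s0.
Unshelve. all: by end_near. Qed.

End MonotoneImplicit.

Ltac smooth_step :=
  match goal with
  | |- class_C _ _ (fun _ => ?c) => exact: class_C_cst
  | |- class_C _ _ (fun x => x) => exact: class_C_id
  | |- class_C ?m ?U (fun x => @GRing.add _ (@?f x) (@GRing.opp _ (@?g x))) =>
      refine (@class_CB _ _ m U f g _ _ _)
  | |- class_C ?m ?U (fun x => @GRing.add _ (@?f x) (@?g x)) =>
      refine (@class_CD _ _ _ m U f g _ _ _)
  | |- class_C ?m ?U (fun x => @GRing.mul _ (@?f x) (@?g x)) =>
      refine (@class_CM _ _ m U f g _ _ _)
  | |- class_C ?m ?U (fun x => @GRing.opp _ (@?f x)) =>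
      refine (@class_CN _ _ m U f _ _)
  | |- class_C ?m ?U (fun x => @GRing.inv _ (@?f x)) =>
      refine (@class_CV _ _ m U f _ _ _)
  | |- class_C ?m ?U (fun x => @GRing.exp _ (@?f x) ?k) =>
      refine (@class_CX _ _ m U f k _ _)
  | |- class_C ?m ?U (fun x => fst (@?f x)) =>
      refine (@class_C_fst _ _ _ _ m U f _ _)
  | |- class_C ?m ?U (fun x => snd (@?f x)) =>
      refine (@class_C_snd _ _ _ _ m U f _ _)
  end.
Ltac smooth := repeat (smooth_step; try done).

(** * Weighted radial projection to the sphere *)

Section Profile.
Context {R : realType}.
Implicit Types (A B m c : R) (p k : nat).

(** The functions m |-> A m^(p+k) + B m^p with 0 <= A and 0 < B increase from 0 to
    infinity with positive speed. They are the functions m^p rho(m^2 y) of m for the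
    weights rho(y) = al y^q + be that occur in the deformation. *)
Lemma profile_lt A B p k m m' : 0 <= A -> 0 < B -> (0 < p)%N -> 0 < m -> m < m' ->
  A * m ^+ (p + k) + B * m ^+ p < A * m' ^+ (p + k) + B * m' ^+ p.
Proof.
move=> A0 B0 p0 m0 mm; apply: ler_ltD.
  by rewrite ler_wpM2l// lerXn2r// ?nnegrE ?ltW// (lt_trans m0).
by rewrite ltr_pM2l// ltrXn2r ?nnegrE ?ltW// ?(lt_trans m0)// -lt0n.
Qed.

Lemma profile_le A B p k m m' : 0 <= A -> 0 < B -> (0 < p)%N -> 0 < m -> 0 < m' ->
  A * m ^+ (p + k) + B * m ^+ p <= A * m' ^+ (p + k) + B * m' ^+ p -> m <= m'.
Proof.
move=> A0 B0 p0 m0 m'0; apply: contraTT; rewrite -!ltNge; exact: profile_lt.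
Qed.

Lemma profile_ex A B p k c : 0 <= A -> 0 < B -> (0 < p)%N -> 0 < c ->
  exists m, 0 < m /\ A * m ^+ (p + k) + B * m ^+ p = c.
Proof.
move=> A0 B0 p0 c0; pose f m := A * m ^+ (p + k) + B * m ^+ p.
have M1 : 1 <= 1 + c / B by rewrite lerDl divr_ge0// ltW.
have f0 : f 0 = 0 by rewrite /f !expr0n addn_eq0 !(gtn_eqF p0)/= !mulr0 addr0.
have fM : c <= f (1 + c / B).
  rewrite /f -[leLHS]add0r; apply: lerD.
    by rewrite mulr_ge0// exprn_ge0// (le_trans _ M1).
  rewrite mulrC -ler_pdivrMr//; apply: (@le_trans _ _ (1 + c / B)).
    by rewrite lerDr.
  by apply: ler_eXnr.
have cf : continuous f.
  move=> m; apply: cvgD; apply: cvgM; try exact: cvg_cst; exact: exprn_continuous.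
have [m /itvP mI fm] : exists2 m, m \in `[0, 1 + c / B]%R & f m = c.
  apply: IVT; [by rewrite (le_trans _ M1)|exact: continuous_subspaceT|].
  by rewrite f0 ge_min le_max fM ltW// orbT.
exists m; split=> //; rewrite lt_neqAle mI andbT; apply/eqP => m0.
by move: fm; rewrite -m0 f0 => /eqP; rewrite lt_eqF.
Qed.

Lemma profile_derive A B p k m : 0 <= A -> 0 < B -> (0 < p)%N -> 0 < m ->
  exists2 d, 0 < d & is_derive m 1 (fun u => A * u ^+ (p + k) + B * u ^+ p) d.
Proof.
move=> A0 B0; case: p => // p _ m0.
exists (A * ((p.+1 + k)%:R * m ^+ (p + k)) + B * (p.+1%:R * m ^+ p)).
  rewrite ltr_wpDl//; first by rewrite !mulr_ge0// exprn_ge0// ltW.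
  by rewrite !mulr_gt0// exprn_gt0.
have dX j : is_derive m 1 (fun u : R => u ^+ j.+1) (j.+1%:R * m ^+ j).
  apply: DeriveDef; first exact: exprn_derivable.
  by rewrite exp_derive /GRing.scale /= mulr1.
have := is_deriveD (is_deriveZ A (dX (p + k)%N)) (is_deriveZ B (dX p)).
exact.
Qed.

End Profile.

Section RealCoordinates.
Context {R : realType} {n : nat}.
Implicit Types (x y : 'rV[R]_(n + n)) (j : 'I_n).

Definition re j x := x 0 (lshift n j).
Definition im j x := x 0 (rshift n j).
Definition sqmod j x := re j x ^+ 2 + im j x ^+ 2.
Definition punctured : set 'rV[R]_(n + n) := [set x | x != 0].

Lemma sqmod_ge0 j x : 0 <= sqmod j x.
Proof. by rewrite addr_ge0 ?sqr_ge0. Qed.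

Lemma sqmod_eq0 j x : (sqmod j x == 0) = (re j x == 0) && (im j x == 0).
Proof. by rewrite paddr_eq0 ?sqr_ge0// !sqrf_eq0. Qed.

Lemma coord_eqP x y : (forall j, re j x = re j y /\ im j x = im j y) -> x = y.
Proof.
move=> H; apply/rowP => i; rewrite -(splitK i).
by case: (fintype.split i) => j /=; case: (H j).
Qed.

Lemma sum_sqmod_gt0 x : punctured x -> 0 < \sum_j sqmod j x.
Proof.
move=> x0; rewrite lt_neqAle sumr_ge0 ?andbT; last by move=> j _; exact: sqmod_ge0.
rewrite eq_sym psumr_eq0; last by move=> j _; exact: sqmod_ge0.
apply: contra x0 => /allP H; apply/eqP/coord_eqP => j.
have := H j (mem_index_enum j); rewrite sqmod_eq0 => /andP[/eqP -> /eqP ->].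
by rewrite /re /im !mxE.
Qed.

Lemma sqmod_gt0 x : punctured x -> exists j, 0 < sqmod j x.
Proof.
move=> /sum_sqmod_gt0; apply: contraPP => /forallNP H; apply/negP; rewrite -leNgt.
by apply: sumr_le0 => j _; rewrite leNgt; apply/negP/H.
Qed.

Lemma open_punctured : open punctured.
Proof.
rewrite (_ : punctured = ~` [set 0]); last by apply/seteqP; split=> x /= /eqP.
by rewrite openC; apply: accessible_closed_set1; apply: hausdorff_accessible; exact: norm_hausdorff.
Qed.

Lemma class_C_re m U j : class_C m U (re j).
Proof. by apply: class_C_linear => x; exact: is_diff_coord. Qed.

Lemma class_C_im m U j : class_C m U (im j).
Proof. by apply: class_C_linear => x; exact: is_diff_coord. Qed.

Lemma class_C_sqmod m U j : open U -> class_C m U (sqmod j).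
Proof.
move=> oU; apply: (@class_CD _ _ _ m U (fun x => re j x ^+ 2) (fun x => im j x ^+ 2)) => //.
  by apply: (@class_CX _ _ m U (re j)) => //; exact: class_C_re.
by apply: (@class_CX _ _ m U (im j)) => //; exact: class_C_im.
Qed.

End RealCoordinates.

Section RadialProjection.
Context {R : realType} {n : nat}.
Variables (r : R) (p q : 'I_n -> nat) (al be : 'I_n -> R).
Variable rho : 'I_n -> 'rV[R]_(n + n) -> R.
Hypotheses (r0 : 0 < r) (p0 : forall j, (0 < p j)%N) (al0 : forall j, 0 <= al j)
  (be0 : forall j, 0 < be j).
Hypotheses (crho : forall j, class_Coo punctured (rho j))
  (rho0 : forall j x, punctured x -> 0 < rho j x).

(** This is m^p rho(m^2 y) for rho(y) = al y^q + be. *)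
Definition profile j (y m : R) := al j * y ^+ q j * m ^+ (p j + 2 * q j) + be j * m ^+ p j.

Local Notation E := 'rV[R]_(n + n).

Let A0 j (x : E) : 0 <= al j * sqmod j x ^+ q j.
Proof. by rewrite mulr_ge0// exprn_ge0// sqmod_ge0. Qed.

(** For w_j = mu_j(c, x) z_j and sigma_j(y) = al_j y^q + be_j the equation reads
    w_j^p sigma_j(|w_j|^2) = c z_j^p rho_j(x), so that zeros of linear forms in the
    z_j^p rho_j(x) become zeros of the same forms in the w_j^p sigma_j(|w_j|^2). *)
Lemma smooth_multiplier : exists mu : 'I_n -> R * E -> R,
  (forall j, class_Coo [set u : R * E | 0 < u.1 /\ punctured u.2] (mu j)) /\
  (forall j (c : R) x, 0 < c -> punctured x -> 0 < mu j (c, x) /\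
     profile j (sqmod j x) (mu j (c, x)) = c * rho j x).
Proof.
have mu_ex j (u : R * E) : exists m : R, 0 < u.1 -> punctured u.2 ->
    0 < m /\ profile j (sqmod j u.2) m = u.1 * rho j u.2.
  have [c0|] := ltP 0 u.1; last by exists 0.
  have [x0|nx] := pselect (punctured u.2); last by exists 0.
  have t0 : 0 < u.1 * rho j u.2 by rewrite mulr_gt0// rho0.
  by have [m Hm] := profile_ex (2 * q j) (A0 j u.2) (be0 j) (p0 j) t0; exists m.
have {mu_ex} mu_ex j := choice (mu_ex j).
pose mu j : R * E -> R := projT1 (mu_ex j); have muP j := projT2 (mu_ex j).
exists mu; split; last first.
  by move=> j c x c0 x0; exact: (muP j (c, x)).
move=> j; set D := [set u | _].
have oD : open D by apply: open_pos_times; exact: open_punctured.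
have oU := open_pos_times oD.
pose F (v : R * (R * E)) := profile j (sqmod j v.2.2) v.1 - v.2.1 * rho j v.2.2.
have cF : class_Coo [set v : R * (R * E) | 0 < v.1 /\ D v.2] F.
  move=> m; rewrite /F /profile; set U := [set v | _] in oU *.
  have cx : class_C m U (fun v : R * (R * E) => v.2.2) by smooth.
  have bE : finite_basis E by exact: finite_basis_rV.
  have cs : class_C m U (fun v : R * (R * E) => sqmod j v.2.2).
    apply: (@class_C_comp_real _ _ _ m U setT (fun v => v.2.2) (sqmod j)) => //.
    exact: class_C_sqmod openT.
  have cr : class_C m U (fun v : R * (R * E) => rho j v.2.2).
    apply: (@class_C_comp_real _ _ _ m U punctured (fun v => v.2.2) (rho j)) => //.
      by move=> x [_ [_]].
    exact: crho.
  by smooth.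
apply: (@smooth_monotone_implicit _ _ D F) => //.
- apply: finite_basis_prod; [exact: finite_basis_real|exact: finite_basis_rV].
- by move=> u [c0 x0]; have [] := muP j u c0 x0.
- by move=> u [c0 x0] /=; have [_ E0] := muP j u c0 x0; rewrite /F E0 subrr.
- move=> u c d _ c0 cd; rewrite /F /= ltrD2r; exact: profile_lt.
- move=> u c Du c0.
  have [d d0 dP] := profile_derive (2 * q j) (A0 j u.2) (be0 j) (p0 j) c0.
  have dPc : is_derive c 1 (fun m => F (m, u)) d.
    by have := is_deriveB dP (is_derive_cst (u.1 * rho j u.2) c 1); rewrite subr0.
  by rewrite (diff_partial _ dPc) ?gt_eqF//; have [dF _] := cF 1%N; apply: dF.
Qed.

(** The curve c |-> (mu_j(c, x) z_j)_j moves outwards with positive speed in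
    each nonzero coordinate, hence crosses the sphere exactly once and
    transversally. *)
Lemma radial_projection : exists (s : E -> R) (mu : 'I_n -> E -> R),
  (forall j, class_Coo punctured (mu j)) /\
  (forall x, punctured x -> 0 < s x /\ \sum_j mu j x ^+ 2 * sqmod j x = r ^+ 2) /\
  (forall j x, punctured x ->
     0 < mu j x /\ profile j (sqmod j x) (mu j x) = s x * rho j x).
Proof.
have [mu [cmu muP]] := smooth_multiplier.
have mu_lt j x (c d : R) : punctured x -> 0 < c -> c < d -> mu j (c, x) < mu j (d, x).
  move=> x0 c0 cd; have d0 := lt_trans c0 cd.
  have [m0 mE] := muP j c x c0 x0; have [m0' mE'] := muP j d x d0 x0.
  rewrite ltNge; apply/negP => le.
  suff : profile j (sqmod j x) (mu j (d, x)) <= profile j (sqmod j x) (mu j (c, x)).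
    by rewrite mE mE' ler_pM2r ?rho0// leNgt cd.
  move: le; rewrite le_eqVlt => /predU1P[->//|lt].
  by apply: ltW; exact: profile_lt.
have oD := @open_punctured R n.
have oU := open_pos_times oD.
pose F (u : R * E) := \sum_j mu j u ^+ 2 * sqmod j u.2 - r ^+ 2.
have cF : class_Coo [set u : R * E | 0 < u.1 /\ punctured u.2] F.
  move=> m; apply: class_CB => //; last exact: class_C_cst.
  apply: class_C_sum => // j _.
  apply: (@class_CM _ _ m _ (fun u => mu j u ^+ 2) (fun u => sqmod j u.2)) => //.
    by apply: (@class_CX _ _ m _ (mu j)) => //; exact: cmu.
  apply: (@class_C_comp_real _ _ _ m _ setT snd (sqmod j)) => //.
  - exact: finite_basis_rV.
  - by apply: (@class_C_snd _ _ _ _ m _ id) => //; exact: class_C_id.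
  - exact: class_C_sqmod openT.
have F_lt x (c d : R) : punctured x -> 0 < c -> c < d -> F (c, x) < F (d, x).
  move=> x0 c0 cd; rewrite /F ltrD2r /=.
  have [j sj] := sqmod_gt0 x0.
  have sq_lt i : mu i (c, x) ^+ 2 < mu i (d, x) ^+ 2.
    have [m0 _] := muP i c x c0 x0; have mcd := mu_lt i x c d x0 c0 cd.
    by rewrite ltrXn2r ?nnegrE ?(ltW m0) ?(ltW (lt_trans m0 mcd)).
  rewrite (bigD1 j)//= [ltRHS](bigD1 j)//=; apply: ltr_leD.
    by rewrite ltr_pM2r.
  by apply: ler_sum => i _; rewrite ler_wpM2r ?sqmod_ge0// ltW.
have mu_le j x (c m : R) : punctured x -> 0 < c -> 0 < m ->
    c * rho j x <= profile j (sqmod j x) m -> mu j (c, x) <= m.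
  move=> x0 c0 m0; have [mm <-] := muP j c x c0 x0; exact: profile_le.
have mu_ge j x (c m : R) : punctured x -> 0 < c -> 0 < m ->
    profile j (sqmod j x) m <= c * rho j x -> m <= mu j (c, x).
  move=> x0 c0 m0; have [mm <-] := muP j c x c0 x0; exact: profile_le.
have prof0 j x m : 0 < m -> 0 < profile j (sqmod j x) m.
  move=> m0; rewrite /profile ltr_wpDl// ?mulr_gt0// ?exprn_gt0//.
  by rewrite mulr_ge0// exprn_ge0// ltW.
have cFc x c : punctured x -> 0 < c -> {for c, continuous (fun c => F (c, x))}.
  move=> x0 c0; apply: (@continuous_comp _ _ _ (fun c => (c, x)) F).
    exact: (cvg_pair cvg_id (cvg_cst x)).
  exact: (cF 0%N (c, x)).
have s_ex x : exists c, punctured x -> 0 < c /\ F (c, x) = 0.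
  have [x0|nx] := pselect (punctured x); last by exists 0.
  have S0 := sum_sqmod_gt0 x0; set S := \sum_j _ in S0.
  pose m := r / Num.sqrt S.
  have m0 : 0 < m by rewrite divr_gt0// sqrtr_gt0.
  have mS : m ^+ 2 * S = r ^+ 2.
    by rewrite /m expr_div_n sqr_sqrtr ?(ltW S0)// divfK// gt_eqF.
  (* all multipliers are at most m at c1 and at least m at c2 *)
  pose c1 := (1 + \sum_j rho j x / profile j (sqmod j x) m)^-1.
  pose c2 := 1 + \sum_j profile j (sqmod j x) m / rho j x.
  have c1' : 0 < 1 + \sum_j rho j x / profile j (sqmod j x) m.
    by rewrite ltr_pwDl// sumr_ge0// => j _; rewrite divr_ge0// ltW ?prof0 ?rho0.
  have c10 : 0 < c1 by rewrite invr_gt0.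
  have c20 : 0 < c2.
    by rewrite ltr_pwDl// sumr_ge0// => j _; rewrite divr_ge0// ltW ?prof0 ?rho0.
  have F1 : F (c1, x) <= 0.
    rewrite subr_le0 -mS mulr_sumr /=; apply: ler_sum => j _.
    have [mj0 _] := muP j c1 x c10 x0.
    rewrite ler_wpM2r ?sqmod_ge0// lerXn2r ?nnegrE ?(ltW m0) ?(ltW mj0)//.
    apply: mu_le => //; rewrite mulrC -ler_pdivlMr// invrK -ler_pdivrMl ?prof0//.
    rewrite mulrC (bigD1 j)//= addrCA lerDl addr_ge0// sumr_ge0// => i _.
    by rewrite divr_ge0// ltW ?prof0 ?rho0.
  have F2 : 0 <= F (c2, x).
    rewrite subr_ge0 -mS mulr_sumr /=; apply: ler_sum => j _.
    have [mj0 _] := muP j c2 x c20 x0.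
    rewrite ler_wpM2r ?sqmod_ge0// lerXn2r ?nnegrE ?(ltW m0) ?(ltW mj0)//.
    apply: mu_ge => //; rewrite -ler_pdivrMr ?rho0//.
    rewrite /c2 (bigD1 j)//= addrCA lerDl addr_ge0// sumr_ge0// => i _.
    by rewrite divr_ge0// ltW ?prof0 ?rho0.
  have c12 : c1 <= c2.
    rewrite leNgt; apply/negP => /(F_lt x _ _ x0 c20).
    by move=> /lt_le_trans/(_ F1); rewrite ltNge F2.
  have [c /itvP cI Fc] : exists2 c, c \in `[c1, c2]%R & F (c, x) = 0.
    apply: (@IVT _ (fun c => F (c, x))) => //; last by rewrite ge_min le_max F1 F2 orbT.
    apply: continuous_in_subspaceT => c /set_mem /= /itvP cI.
    by apply: cFc => //; rewrite (lt_le_trans c10)// cI.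
  by exists c => _; split=> //; rewrite (lt_le_trans c10)// cI.
have [s sP] := choice s_ex.
have cs : class_Coo punctured s.
  apply: (smooth_monotone_implicit (finite_basis_rV _) oD cF) => //.
  - by move=> x /sP[].
  - by move=> x /sP[].
  - move=> x c x0 c0.
    have dmu j : 0 < 'd (mu j) (c, x) (1, 0) /\
        is_derive c 1 (fun u => mu j (u, x)) ('d (mu j) (c, x) (1, 0)).
      have dmuj : is_derive c 1 (fun u => mu j (u, x)) ('d (mu j) (c, x) (1, 0)).
        by apply: is_derive_partial; have [dm _] := cmu j 1%N; apply: dm.
      split=> //; have [m0 _] := muP j c x c0 x0.
      have [d d0 dP] := profile_derive (2 * q j) (A0 j x) (be0 j) (p0 j) m0.
      have dl : is_derive c 1 (fun u => u * rho j x) (rho j x).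
        have := is_deriveZ (rho j x) (is_derive_id c 1).
        rewrite [_ *: 1]mulr1 (_ : _ \*: _ = fun u => u * rho j x) //.
        by apply/funext => u; rewrite [RHS]mulrC.
      have dr : is_derive c 1 (fun u => u * rho j x) ('d (mu j) (c, x) (1, 0) * d).
        pose h (u : R) := profile j (sqmod j x) (mu j (u, x)).
        have dh : is_derive c 1 h (d * 'd (mu j) (c, x) (1, 0)).
          exact: (@is_derive1_comp _ (profile j (sqmod j x)) (fun u => mu j (u, x)) c _ _ dP dmuj).
        rewrite mulrC; apply: near_eq_is_derive dh.
        have := lt_nbhsr c0; apply: filterS => u /= u0.
        by have [_] := muP j u x u0 x0.
      have : 'd (mu j) (c, x) (1, 0) * d = rho j x by case: dl => _ <-; case: dr => _ <-.
      by move=> H; have := rho0 j x0; rewrite -H pmulr_lgt0.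
    pose d := \sum_j (2 * mu j (c, x) * 'd (mu j) (c, x) (1, 0)) * sqmod j x.
    have dF : is_derive c 1 (fun u => F (u, x)) d.
      have dj j : is_derive c 1 (fun u => mu j (u, x) ^+ 2 * sqmod j x)
          ((2 * mu j (c, x) * 'd (mu j) (c, x) (1, 0)) * sqmod j x).
        have [_ dm] := dmu j.
        have dm2 := is_deriveM dm dm.
        have := is_deriveZ (sqmod j x) dm2.
        set h := _ \*: _; have -> : h = fun u => mu j (u, x) ^+ 2 * sqmod j x.
          by apply/funext => u; rewrite [LHS]mulrC expr2.
        move=> dh; apply: (is_derive_eq dh); rewrite /GRing.scale /=; ring.
      have := is_deriveB (is_derive_sum dj) (is_derive_cst (r ^+ 2) c 1).
      rewrite subr0 fct_sumE; exact.
    have [dF1 _] := cF 1%N.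
    rewrite (diff_partial (dF1 (c, x) _) dF)// gt_eqF//.
    have [j sj] := sqmod_gt0 x0.
    have d_ge i : 0 <= (2 * mu i (c, x) * 'd (mu i) (c, x) (1, 0)) * sqmod i x.
      have [d0 _] := dmu i; have [m0 _] := muP i c x c0 x0.
      by rewrite mulr_ge0 ?sqmod_ge0// ltW// !mulr_gt0.
    rewrite /d (bigD1 j)//= ltr_pwDl ?sumr_ge0//.
    have [d0 _] := dmu j; have [m0 _] := muP j c x c0 x0.
    by rewrite !mulr_gt0.
exists s, (fun j x => mu j (s x, x)); split; last split.
- move=> j m; apply: (@class_C_comp_real _ _ _ m _ _ (fun x => (s x, x)) (mu j)) => //; last exact: cmu.
  + apply: finite_basis_prod; [exact: finite_basis_real|exact: finite_basis_rV].
  + by move=> x x0; split=> //=; have [] := sP x x0.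
  + by apply: class_C_pair => //; exact: class_C_id.
- by move=> x x0; have [? /subr0_eq] := sP x x0.
- by move=> j x x0; apply: muP => //; have [] := sP x x0.
Qed.

End RadialProjection.

(** * Equivalence of links *)

Section Uniqueness.
Context {R : realType} {n : nat}.
Variables (p q : 'I_n -> nat) (al be : 'I_n -> R).
Hypotheses (p0 : forall j, (0 < p j)%N) (al0 : forall j, 0 <= al j)
  (be0 : forall j, 0 < be j).

(** All the multipliers increase with s, hence so does the norm of the resulting
    point: a curve of such points meets a sphere only once. *)
Lemma multipliers_unique (x : 'rV[R]_(n + n)) (w m m' : 'I_n -> R) (s s' : R) :
  punctured x -> (forall j, 0 < w j) -> (forall j, 0 < m j) -> (forall j, 0 < m' j) ->
  (forall j, profile p q al be j (sqmod j x) (m j) = s * w j) ->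
  (forall j, profile p q al be j (sqmod j x) (m' j) = s' * w j) ->
  \sum_j m j ^+ 2 * sqmod j x = \sum_j m' j ^+ 2 * sqmod j x -> m =1 m'.
Proof.
move=> x0 w0; wlog ss : m m' s s' / s <= s'.
  move=> H m0 m0' mE mE' mm; have [/H|/ltW/H] := leP s s'; first exact.
  by move=> H' j; rewrite (H' m' m).
move=> m0 m0' mE mE' mm.
have A0 j : 0 <= al j * sqmod j x ^+ q j by rewrite mulr_ge0// exprn_ge0// sqmod_ge0.
have le j : m j <= m' j.
  apply: (profile_le (k := 2 * q j) (A0 j) (be0 j) (p0 j)) => //.
  by rewrite -![_ + _]/(profile p q al be j (sqmod j x) _) mE mE' ler_pM2r.
have [j sj] := sqmod_gt0 x0.
have mj : m j = m' j.
  apply/eqP; rewrite -(@eqrXn2 _ 2)// ?ltW//; apply/eqP.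
  have le2 i : m i ^+ 2 * sqmod i x <= m' i ^+ 2 * sqmod i x.
    by rewrite ler_wpM2r ?sqmod_ge0// lerXn2r// nnegrE ltW.
  apply: (mulIf (lt0r_neq0 sj)); apply/eqP; rewrite eq_le le2 /= leNgt; apply/negP => lt.
  move: mm => /eqP; rewrite lt_eqF// (bigD1 j)//= [ltRHS](bigD1 j)//=.
  by apply: ltr_leD => //; apply: ler_sum.
have sE : s = s'.
  by apply: (mulIf (lt0r_neq0 (w0 j))); rewrite -mE -mE' mj.
move=> i; apply/eqP; rewrite eq_le le /=.
apply: (profile_le (k := 2 * q i) (A0 i) (be0 i) (p0 i)) => //.
by rewrite -![_ + _]/(profile p q al be i (sqmod i x) _) mE mE' sE.
Qed.

End Uniqueness.

Section LinkEquivalence.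
Context {R : realType} {n k : nat}.
Local Notation E := 'rV[R]_(n + n).
Implicit Types (x y : E) (H : 'rV[R[i]]_n -> 'rV[R[i]]_k).

Definition real_sphere (r : R) : set E := [set x | \sum_j sqmod j x = r ^+ 2].

Definition smooth_near (S : set E) (f : E -> E) :=
  exists U, [/\ open U, S `<=` U & class_Coo U f].

Lemma smooth_near_comp (S : set E) (f g : E -> E) :
  smooth_near S f -> smooth_near S g -> (forall x, S x -> S (f x)) ->
  smooth_near S (g \o f).
Proof.
move=> [U [oU SU cf]] [U' [oU' SU' cg]] Sf.
have oUf := open_preimage oU oU' (cf 0%N).
exists (U `&` f @^-1` U'); split=> //.
  by move=> x Sx; split; [exact: SU|apply/SU'/Sf].
move=> m; apply: (@class_C_comp _ _ _ _ m _ U') => //; try exact: finite_basis_rV.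
- by move=> x [].
- by apply: class_C_sub (cf m) => x [].
Qed.

(** Respecting the vanishing of each single coordinate is what makes psi restrict to
    all coordinate spheres at once. *)
Definition link_equiv (r : R) H1 H2 := exists psi phi : E -> E,
  [/\ smooth_near (real_sphere r) psi /\ smooth_near (real_sphere r) phi,
      forall x, real_sphere r x -> real_sphere r (psi x) /\ phi (psi x) = x,
      forall x, real_sphere r x -> real_sphere r (phi x) /\ psi (phi x) = x,
      forall j x, real_sphere r x -> sqmod j x = 0 <-> sqmod j (psi x) = 0 &
      forall x, real_sphere r x ->
        H1 (complexify x) = 0 <-> H2 (complexify (psi x)) = 0].

Lemma link_equiv_sym r H1 H2 : link_equiv r H1 H2 -> link_equiv r H2 H1.
Proof.
move=> [psi [phi [[cpsi cphi] psiS phiS psi0 psiH]]]; exists phi, psi; split=> //.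
  by move=> j x Sx; have [Sp pE] := phiS x Sx; rewrite -{1}pE; exact: iff_sym (psi0 j _ Sp).
by move=> x Sx; have [Sp pE] := phiS x Sx; rewrite -{1}pE; exact: iff_sym (psiH _ Sp).
Qed.

Lemma link_equiv_trans r H1 H2 H3 :
  link_equiv r H1 H2 -> link_equiv r H2 H3 -> link_equiv r H1 H3.
Proof.
move=> [f [f' [[cf cf'] fS fS' f0 fH]]] [g [g' [[cg cg'] gS gS' g0 gH]]].
exists (g \o f), (f' \o g'); split.
- split; apply: smooth_near_comp => //.
    by move=> x /fS[].
  by move=> x /gS'[].
- move=> x Sx /=; have [Sf fK] := fS x Sx; have [Sg gK] := gS _ Sf.
  by split=> //; rewrite gK.
- move=> x Sx /=; have [Sf fK] := gS' x Sx; have [Sg gK] := fS' _ Sf.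
  by split=> //; rewrite gK.
- by move=> j x Sx; apply: (iff_trans (f0 j x Sx)); apply: g0; have [] := fS x Sx.
- by move=> x Sx; apply: (iff_trans (fH x Sx)); apply: gH; have [] := fS x Sx.
Qed.

End LinkEquivalence.

(** * Deformations at positive times *)

Section WeightedHamm.
Context {R : realType} {n k : nat}.
Local Notation E := 'rV[R]_(n + n).
Implicit Types (x y : E) (m : 'I_n -> R).

Definition stretch m x : E :=
  row_mx (\row_j (m j * re j x)) (\row_j (m j * im j x)).

Lemma re_stretch m x j : re j (stretch m x) = m j * re j x.
Proof. by rewrite /re row_mxEl mxE. Qed.

Lemma im_stretch m x j : im j (stretch m x) = m j * im j x.
Proof. by rewrite /im row_mxEr mxE. Qed.

Lemma sqmod_stretch m x j : sqmod j (stretch m x) = m j ^+ 2 * sqmod j x.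
Proof. by rewrite /sqmod re_stretch im_stretch !exprMn mulrDr. Qed.

Lemma stretch1 m x : (forall j, m j = 1) -> stretch m x = x.
Proof. by move=> m1; apply: coord_eqP => j; rewrite re_stretch im_stretch m1 !mul1r. Qed.

Lemma stretch_comp m m' x : stretch m (stretch m' x) = stretch (fun j => m j * m' j) x.
Proof. by apply: coord_eqP => j; rewrite !re_stretch !im_stretch !mulrA. Qed.

Lemma complexify_coord x j : complexify x 0 j = re j x +i* im j x.
Proof. by rewrite !mxE. Qed.

Lemma complexify_stretch m x j : complexify (stretch m x) 0 j = (m j)%:C * complexify x 0 j.
Proof.
rewrite !complexify_coord re_stretch im_stretch; apply/eqP; rewrite eq_complex /=.
by rewrite !mul0r subr0 addr0 !eqxx.
Qed.

Lemma smooth_stretch (U : set E) (mu : 'I_n -> E -> R) : open U ->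
  (forall j, class_Coo U (mu j)) -> class_Coo U (fun x => stretch (mu ^~ x) x).
Proof.
move=> oU cmu m; apply: class_C_rV => // i; rewrite -(splitK i).
case: (fintype.split i) => j /=.
  rewrite (_ : (fun _ => _) = fun x => mu j x * re j x).
    by apply: class_CM => //; [exact: cmu|exact: class_C_re].
  by apply/funext => x; exact: re_stretch.
rewrite (_ : (fun _ => _) = fun x => mu j x * im j x).
  by apply: class_CM => //; [exact: cmu|exact: class_C_im].
by apply/funext => x; exact: im_stretch.
Qed.

Lemma sphere_punctured r x : 0 < r -> real_sphere r x -> punctured x.
Proof.
move=> r0 Sx; apply/eqP => x0; move: Sx; rewrite /real_sphere /= x0.
rewrite big1 => [|j _]; last by rewrite /sqmod /re /im !mxE expr0n addr0.
by move/eqP; rewrite lt_eqF// exprn_gt0.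
Qed.

Variables (Lam : 'M[R[i]]_(k, n)) (a b : 'I_n -> nat).
Hypothesis a0 : forall j, (0 < a j)%N.

(** All the maps in question have the form
    sum_j Lam i j z_j^(a_j) rho_j(|z_j|^2) with rho_j(y) = al_j y^(b_j) + be_j,
    and in this form the source and the target play symmetric roles. *)
Definition weighted_hamm (al be : 'I_n -> R) (z : 'rV[R[i]]_n) : 'rV[R[i]]_k :=
  \row_i \sum_j Lam i j * (z 0 j ^+ a j *
    (al j)%:C * (z 0 j * (z 0 j)^*) ^+ b j + z 0 j ^+ a j * (be j)%:C).

Lemma normsq_complexify x j :
  complexify x 0 j * (complexify x 0 j)^* = (sqmod j x)%:C.
Proof.
rewrite complexify_coord; apply/eqP; rewrite eq_complex /sqmod /=.
by rewrite !mulrN opprK -!expr2 eqxx /= [im j x * _]mulrC addNr.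
Qed.

Lemma weighted_hammE al be x : weighted_hamm al be (complexify x) =
  \row_i \sum_j Lam i j * (complexify x 0 j ^+ a j *
     (al j * sqmod j x ^+ b j + be j)%:C).
Proof.
apply/rowP => i; rewrite !mxE; apply: eq_bigr => j _; congr (_ * _).
by rewrite normsq_complexify [(_ + be j)%:C]rmorphD rmorphM rmorphXn mulrDr !mulrA.
Qed.

Lemma weighted_hamm_stretch al be al' be' m s x :
  (forall j, profile a b al' be' j (sqmod j x) (m j) = s * (al j * sqmod j x ^+ b j + be j)) ->
  weighted_hamm al' be' (complexify (stretch m x)) = s%:C *: weighted_hamm al be (complexify x).
Proof.
move=> mE; apply/rowP => i; rewrite !weighted_hammE !mxE mulr_sumr.
apply: eq_bigr => j _; rewrite complexify_stretch sqmod_stretch.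
rewrite [RHS]mulrCA; congr (_ * _); rewrite [RHS]mulrCA -rmorphM -mE.
rewrite exprMn mulrAC mulrC -rmorphXn -[in LHS]mulrA; congr (_ * _).
rewrite -rmorphM /profile; congr (_%:C); rewrite exprD exprM !exprMn; ring.
Qed.

(** The map z |-> w = (mu_j z_j)_j with
    mu_j^(a_j) rho'_j(|w_j|^2) = s rho_j(|z_j|^2), where s is chosen so that w lies
    on the sphere, multiplies the equations by s. Exchanging the two families of
    weights turns it into its inverse, by [multipliers_unique]. Positivity of be
    makes the multipliers smooth and positive also where z_j = 0. *)
Lemma weighted_hamm_equiv (r : R) (al be al' be' : 'I_n -> R) : 0 < r ->
  (forall j, 0 <= al j) -> (forall j, 0 < be j) ->
  (forall j, 0 <= al' j) -> (forall j, 0 < be' j) ->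
  link_equiv r (weighted_hamm al be) (weighted_hamm al' be').
Proof.
move=> r0 al0 be0 al0' be0'.
pose rho (al be : 'I_n -> R) j x := al j * sqmod j x ^+ b j + be j.
have rho_gt0 (c d : 'I_n -> R) j x : (forall j, 0 <= c j) -> (forall j, 0 < d j) -> 0 < rho c d j x.
  by move=> c0 d0; rewrite ltr_wpDl// mulr_ge0// exprn_ge0// sqmod_ge0.
have crho c d j : class_Coo punctured (rho c d j).
  move=> m; have oP := @open_punctured R n.
  apply: (@class_CD _ _ _ m _ (fun x => c j * sqmod j x ^+ b j)) => //; last exact: class_C_cst.
  apply: (@class_CM _ _ m _ (fun=> c j) (fun x => sqmod j x ^+ b j)) => //; first exact: class_C_cst.
  by apply: (@class_CX _ _ m _ (sqmod j)) => //; exact: class_C_sqmod.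
have inv (c d c' d' : 'I_n -> R) (mu nu : 'I_n -> E -> R) (s s' : E -> R) : 
    (forall j, 0 <= c j) -> (forall j, 0 < d j) ->
    (forall j, 0 <= c' j) -> (forall j, 0 < d' j) ->
    (forall x, punctured x -> 0 < s x /\ \sum_j mu j x ^+ 2 * sqmod j x = r ^+ 2) ->
    (forall j x, punctured x ->
      0 < mu j x /\ profile a b c' d' j (sqmod j x) (mu j x) = s x * rho c d j x) ->
    (forall x, punctured x -> 0 < s' x /\ \sum_j nu j x ^+ 2 * sqmod j x = r ^+ 2) ->
    (forall j x, punctured x ->
      0 < nu j x /\ profile a b c d j (sqmod j x) (nu j x) = s' x * rho c' d' j x) ->
    forall x, real_sphere r x -> real_sphere r (stretch (mu ^~ x) x) /\
      stretch (nu ^~ (stretch (mu ^~ x) x)) (stretch (mu ^~ x) x) = x.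
  move=> c0 d0 c0' d0' sH muH sH' nuH x Sx; set y := stretch (mu ^~ x) x.
  have x0 := sphere_punctured r0 Sx; have [s0 sE] := sH x x0.
  have Sy : real_sphere r y.
    by rewrite /real_sphere /= -sE; apply: eq_bigr => j _; rewrite sqmod_stretch.
  split=> //; have y0 := sphere_punctured r0 Sy.
  have mu0 j : 0 < mu j x by have [] := muH j x x0.
  rewrite stretch_comp; apply: stretch1 => j.
  suff <- : (mu j x)^-1 = nu j y by rewrite mulVf// gt_eqF.
  apply: (@multipliers_unique _ _ a b c d a0 c0 d0 y (fun j => rho c' d' j y)
    (fun j => (mu j x)^-1) (fun j => nu j y) (s x)^-1 (s' y)) => //.
  - by move=> i; exact: rho_gt0.
  - by move=> i; rewrite invr_gt0.
  - by move=> i; have [] := nuH i y y0.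
  - move=> i; have [_ mE] := muH i x x0.
    apply: (mulfI (lt0r_neq0 s0)); rewrite mulrA mulfV ?gt_eqF// mul1r.
    have {mE} : s x * rho c d i x = mu i x ^+ a i * rho c' d' i y.
      rewrite -mE /profile /rho sqmod_stretch exprD exprM !exprMn; ring.
    have mn : mu i x != 0 by rewrite gt_eqF.
    rewrite /profile exprD exprM {1}/y sqmod_stretch -/y => H.
    apply: (mulfI (expf_neq0 (a i) mn)); rewrite -H /rho.
    have e1 : mu i x ^+ a i * (mu i x)^-1 ^+ a i = 1 by rewrite -exprMn mulfV// expr1n.
    have e2 : mu i x ^+ b i * (mu i x)^-1 ^+ b i = 1 by rewrite -exprMn mulfV// expr1n.
    rewrite !exprMn; set A := mu i x ^+ a i in e1 *; set A' := _^-1 ^+ a i in e1 *.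
    set B := mu i x ^+ b i in e2 *; set B' := _^-1 ^+ b i in e2 *.
    transitivity (s x * (c i * sqmod i x ^+ b i * (B * B') ^+ 2 + d i) * (A * A')); first ring.
    by rewrite e1 e2; ring.
  - by move=> i; have [] := nuH i y y0.
  - have [_ ->] := sH' y y0; rewrite -Sx; apply: eq_bigr => i _.
    by rewrite sqmod_stretch mulrA exprVn mulVf ?mul1r// expf_neq0// gt_eqF.
have [s [mu [cmu [sP muP]]]] := radial_projection b r0 a0 al0' be0' (crho al be)
  (fun j x _ => rho_gt0 al be j x al0 be0).
have [s' [nu [cnu [sP' nuP]]]] := radial_projection b r0 a0 al0 be0 (crho al' be')
  (fun j x _ => rho_gt0 al' be' j x al0' be0').
have smo (m : 'I_n -> E -> R) : (forall j, class_Coo punctured (m j)) ->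
    smooth_near (real_sphere r) (fun x => stretch (m ^~ x) x).
  move=> cm; exists punctured; split; first exact: open_punctured.
    by move=> x; exact: sphere_punctured.
  by apply: smooth_stretch => //; exact: open_punctured.
exists (fun x => stretch (mu ^~ x) x), (fun x => stretch (nu ^~ x) x); split.
- by split; apply: smo.
- exact: (inv al be al' be' mu nu s s').
- exact: (inv al' be' al be nu mu s' s).
- move=> j x Sx; have [m0 _] := muP j x (sphere_punctured r0 Sx).
  rewrite sqmod_stretch; split=> [->|/eqP]; first by rewrite mulr0.
  by rewrite mulf_eq0 expf_eq0 (gt_eqF m0) => /eqP.
- move=> x Sx; have x0 := sphere_punctured r0 Sx.
  rewrite (weighted_hamm_stretch (s := s x) (al := al) (be := be)); last first.
    by move=> j; have [_ ->] := muP j x x0.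
  have [s0 _] := sP x x0; split=> [->|/eqP]; first by rewrite scaler0.
  rewrite scaler_eq0 => /orP[|/eqP//].
  by rewrite eq_complex /= (gt_eqF s0).
Qed.

Lemma hamm_deformationE (t : R) :
  hamm_deformation Lam a b t = weighted_hamm (fun=> 1 - t) (fun=> t).
Proof.
apply/funext => z; apply/rowP => i; rewrite !mxE !mulr_sumr -big_split /=.
apply: eq_bigr => j _; rewrite exprD exprMn; ring.
Qed.

Lemma hammE : hamm Lam a = weighted_hamm (fun=> 0) (fun=> 1).
Proof.
apply/funext => z; apply/rowP => i; rewrite !mxE.
by apply: eq_bigr => j _; rewrite mulr0 mul0r add0r mulr1.
Qed.

Lemma hamm_deformation_equiv r t : 0 < r -> 0 < t -> t <= 1 ->
  link_equiv r (hamm_deformation Lam a b t) (hamm Lam a).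
Proof.
move=> r0 t0 t1; rewrite hamm_deformationE hammE; apply: weighted_hamm_equiv => // _.
by rewrite subr_ge0.
Qed.

End WeightedHamm.

(** * Perturbations of the identity of the sphere *)

Section Tools.
Context {R : realType}.
Implicit Types V W : normedModType R.

Lemma near_compact_tube V W (K : set W) (v : V) (P : V * W -> Prop) : compact K ->
  (forall x, K x -> \forall q \near (v, x), P q) ->
  \forall u \near v, forall x, K x -> P (u, x).
Proof.
move=> /compact_near_coveringP cK H.
apply: (cK V (nbhs v) (fun u x => P (u, x))) => x /H [[A B] /= [nA nB] AB].
exists (B, A) => //= -[y u] /= [By Au]; exact: AB.
Qed.

Lemma continuous_near_small V W (h : V -> W) v (d : R) : 0 < d ->
  {for v, continuous h} -> h v = 0 -> \forall u \near v, `|h u| < d.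
Proof.
move=> d0 /cvgr_dist_lt/(_ _ d0) + h0; rewrite h0 near_map; apply: filterS => u.
by rewrite sub0r normrN.
Qed.

(** The mean value inequality, coordinate by coordinate for the sup norm. *)
Lemma mean_value_bound V N (X : V -> 'rV[R]_N) (x y : V) (C : R) :
  (forall t : R, 0 <= t <= 1 -> differentiable X (y + t *: (x - y)) /\
     `|'d X (y + t *: (x - y)) (x - y)| <= C) ->
  `|X x - X y| <= C.
Proof.
move=> H; pose p (t : R) := y + t *: (x - y).
have dp t : is_diff t p (fun u : R => u *: (x - y)).
  have := is_diffD (is_diff_cst y t) (is_diff_scaleDl (x - y) t).
  by rewrite add0r.
have C0 : 0 <= C by have [|_] := H 0; [rewrite lexx ler01|exact: le_trans].
rewrite [leLHS]/Num.Def.normr/= mx_normrE (bigmax_le _ C0)//= => -[i j] _ /=.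
rewrite (ord1 i) {i} !mxE.
pose g (t : R) : R := X (p t) 0 j.
have dg (t : R) : 0 <= t <= 1 -> is_derive t 1 g ('d X (p t) (x - y) 0 j).
  move=> /H [/differentiableP dX _].
  have [dgt dgE] : is_diff t g (fun u => 'd X (p t) (u *: (x - y)) 0 j).
    exact: (is_diff_comp (is_diff_comp (dp t) dX) (is_diff_coord j _)).
  by apply: DeriveDef; [exact: diff_derivable|rewrite deriveE// dgE scale1r].
have [t /itvP tI gE] : exists2 t, t \in `[0, 1]%R & g 1 - g 0 = 'd X (p t) (x - y) 0 j * (1 - 0).
  apply: MVT_segment => // [t /itvP tI|].
    by apply: dg; rewrite !tI.
  apply: derivable_within_continuous => t /itvP tI.
  by have [|//] := dg t; rewrite !tI.
have -> : X x 0 j - X y 0 j = g 1 - g 0.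
  by rewrite /g /p scale1r scale0r addr0 (addrC y) subrK.
rewrite gE subr0 mulr1; have [|_] := H t; [by rewrite !tI|apply: le_trans].
rewrite [leRHS]/Num.Def.normr/= mx_normrE.
exact: (le_bigmax _ (fun k => `|('d X (p t) (x - y)) k.1 k.2|) (0, j)).
Qed.

(** The solutions are the fixed points of T x = y - X x, which maps the ball of
    radius 2 |y| to itself. T halves distances, so that the displacement
    |x - T x| can only be minimal on this compact ball if it is 0. *)
Lemma contraction_perturbation_onto N (X : 'rV[R]_N -> 'rV[R]_N) :
  X 0 = 0 -> (forall x y, `|X x - X y| <= 2^-1 * `|x - y|) ->
  forall y, exists x, x + X x = y.
Proof.
move=> X0 lX y; pose T x := y - X x.
have cX : continuous X by exact: lipschitz_continuous lX.
have cT : continuous (fun x : 'rV[R]_N => `|x - T x|).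
  apply: (@lipschitz_continuous _ _ _ _ 2) => u v.
  apply: (le_trans (ler_dist_dist _ _)).
  have -> : u - T u - (v - T v) = (u - v) + (X u - X v).
    by rewrite /T; apply/rowP => i; rewrite !mxE; ring.
  by rewrite (le_trans (ler_normD _ _))//; have := lX u v; have := normr_ge0 (u - v); lra.
pose B := [set x : 'rV[R]_N | `|x| <= 2 * `|y|].
have B0 : B !=set0 by exists 0; rewrite /B /= normr0 mulr_ge0.
have cB : compact B.
  apply: bounded_closed_compact.
    exists (2 * `|y|); split; first exact: num_real.
    by move=> M yM x Bx; exact: le_trans Bx (ltW yM).
  rewrite (_ : B = Num.norm @^-1` [set u | u <= 2 * `|y|]) //.
  by apply: closed_comp; [move=> x _; exact: norm_continuous|exact: closed_le].
have TB x : B x -> B (T x).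
  rewrite /B /T /= => Bx; apply: (le_trans (ler_normB _ _)).
  have := lX x 0; rewrite X0 !subr0; lra.
have [x /set_mem Bx xmin] : exists2 c, c \in B & forall t, t \in B -> `|c - T c| <= `|t - T t|.
  by apply: EVT_min_rV => //; exact: continuous_subspaceT.
exists x; have /xmin : T x \in B by apply/mem_set/TB.
have -> : T x - T (T x) = X (T x) - X x by rewrite /T; apply/rowP => i; rewrite !mxE; ring.
move=> /le_trans/(_ (lX _ _)); rewrite distrC => le.
have : `|x - T x| <= 0 by rewrite distrC; have := normr_ge0 (T x - x); lra.
by rewrite normr_le0 subr_eq0 => /eqP {1}->; rewrite /T subrK.
Qed.

End Tools.

Section Norm.
Context {R : realType} {n : nat}.
Local Notation E := 'rV[R]_(n + n).
Implicit Types (x y : E).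

Definition nrm x := Num.sqrt (\sum_j sqmod j x).

Lemma sqmodZ c x j : sqmod j (c *: x) = c ^+ 2 * sqmod j x.
Proof. by rewrite /sqmod /re /im !mxE !exprMn mulrDr. Qed.

Lemma sum_sqmod_ge0 x : 0 <= \sum_j sqmod j x.
Proof. by rewrite sumr_ge0// => j _; exact: sqmod_ge0. Qed.

Lemma nrmZ c x : 0 <= c -> nrm (c *: x) = c * nrm x.
Proof.
move=> c0; rewrite /nrm; under eq_bigr do rewrite sqmodZ.
by rewrite -mulr_sumr sqrtrM ?sqr_ge0// sqrtr_sqr ger0_norm.
Qed.

Lemma nrm0 : nrm 0 = 0.
Proof. by rewrite -[X in nrm X](scale0r 0) nrmZ// mul0r. Qed.

Lemma nrm_gt0 x : punctured x -> 0 < nrm x.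
Proof. by move=> /sum_sqmod_gt0; rewrite sqrtr_gt0. Qed.

Lemma nrm_eq r x : 0 < r -> real_sphere r x <-> nrm x = r.
Proof.
move=> r0; rewrite /real_sphere /nrm; split=> /= [->|<-].
  by rewrite sqrtr_sqr gtr0_norm.
by rewrite sqr_sqrtr// sum_sqmod_ge0.
Qed.

Lemma class_C_nrm m : class_C m punctured nrm.
Proof.
have oD := @open_punctured R n.
apply: (@class_C_comp_function _ _ m _ [set u : R | 0 < u]
  (fun x : E => \sum_j sqmod j x) Num.sqrt) => //.
- by move=> x; exact: sum_sqmod_gt0.
- by apply: class_C_sum => // j _; exact: class_C_sqmod.
- exact: class_C_sqrt.
Qed.

End Norm.

Section HomogeneousExtension.
Context {R : realType} {n : nat}.
Local Notation E := 'rV[R]_(n + n).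
Implicit Types (x y : E).
Variables (r : R) (U : set (R * E)) (F : R * E -> E).
Hypotheses (r0 : 0 < r) (oU : open U) (cF : class_Coo U F)
  (US : forall x, real_sphere r x -> U (0, x))
  (F0 : forall x, real_sphere r x -> F (0, x) = x)
  (FS : forall q, U q -> real_sphere r q.2 -> real_sphere r (F q)).

Definition to_sphere x := (r / nrm x) *: x.

(** The deviation from the identity of the extension of F that is homogeneous
    of degree 1. *)
Definition deviation (q : R * E) := (nrm q.2 / r) *: F (q.1, to_sphere q.2) - q.2.

Definition extension_domain : set (R * E) :=
  [set q | punctured q.2] `&` (fun q : R * E => (q.1, to_sphere q.2)) @^-1` U.

Lemma to_sphereP x : punctured x -> real_sphere r (to_sphere x).
Proof.
move=> x0; apply/(nrm_eq _ r0); have nx := nrm_gt0 x0.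
by rewrite nrmZ ?divr_ge0 ?ltW// divfK// gt_eqF.
Qed.

Lemma to_sphere_id x : real_sphere r x -> to_sphere x = x.
Proof. by move=> /(nrm_eq _ r0) nx; rewrite /to_sphere nx divff ?scale1r// gt_eqF. Qed.

Lemma to_sphereZ c x : 0 < c -> to_sphere (c *: x) = to_sphere x.
Proof.
move=> c0; rewrite /to_sphere nrmZ ?(ltW c0)// scalerA; congr (_ *: x).
by rewrite invfM mulrA -[r / c / _ * c]mulrA [_^-1 * c]mulrC mulrA divfK// gt_eqF.
Qed.

Lemma punctured2_open : open [set q : R * E | punctured q.2].
Proof.
rewrite (_ : [set _ | _] = snd @^-1` punctured) //.
by apply: open_comp; [move=> q _; exact: cvg_snd|exact: open_punctured].
Qed.

Lemma class_C_to_sphere_snd m :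
  class_C m [set q : R * E | punctured q.2] (fun q : R * E => (q.1, to_sphere q.2)).
Proof.
have oP := punctured2_open.
have c2 : class_C m [set q : R * E | punctured q.2] (fun q : R * E => q.2).
  by apply: (@class_C_snd _ _ _ _ m _ id) => //; exact: class_C_id.
apply: class_C_pair => //.
  by apply: (@class_C_fst _ _ _ _ m _ id) => //; exact: class_C_id.
apply: class_CZ => //.
apply: class_CM => //; first exact: class_C_cst.
apply: class_CV => //; first by move=> q /nrm_gt0/lt0r_neq0.
apply: (@class_C_comp_real _ _ _ m _ punctured (fun q : R * E => q.2) nrm) => //.
  exact: finite_basis_rV.
exact: class_C_nrm.
Qed.

Lemma extension_domain_open : open extension_domain.
Proof.
apply: open_preimage => //; first exact: punctured2_open.
by apply: class_C_continuous (class_C_to_sphere_snd 0).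
Qed.

Lemma smooth_deviation : class_Coo extension_domain deviation.
Proof.
move=> m; have oD := extension_domain_open.
have sD : extension_domain `<=` [set q : R * E | punctured q.2] by move=> q [].
have c2 : class_C m extension_domain (fun q : R * E => q.2).
  by apply: (@class_C_snd _ _ _ _ m _ id) => //; exact: class_C_id.
rewrite (_ : deviation = fun q => (nrm q.2 / r) *: F (q.1, to_sphere q.2) + (-1) *: q.2).
  apply: class_CD => //.
    apply: class_CZ => //.
      apply: class_CM => //; last exact: class_C_cst.
      apply: (@class_C_comp_real _ _ _ m _ punctured (fun q : R * E => q.2) nrm) => //.
        exact: finite_basis_rV.
      exact: class_C_nrm.
    apply: (@class_C_comp _ _ _ _ m _ U (fun q : R * E => (q.1, to_sphere q.2)) F) => //.
    - by apply: finite_basis_prod; [exact: finite_basis_real|exact: finite_basis_rV].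
    - exact: finite_basis_rV.
    - by move=> q [].
    - exact: class_C_sub (class_C_to_sphere_snd m).
  by apply: class_CZ => //; exact: class_C_cst.
by apply/funext => q; rewrite scaleN1r.
Qed.

End HomogeneousExtension.

Section Perturbation.
Context {R : realType} {n : nat}.
Local Notation E := 'rV[R]_(n + n).
Implicit Types (x y : E).
Variables (r : R) (U : set (R * E)) (F : R * E -> E).
Hypotheses (r0 : 0 < r) (oU : open U) (cF : class_Coo U F)
  (US : forall x, real_sphere r x -> U (0, x))
  (F0 : forall x, real_sphere r x -> F (0, x) = x)
  (FS : forall q, U q -> real_sphere r q.2 -> real_sphere r (F q)).
Local Notation D := (extension_domain r U).
Local Notation X := (deviation r F).

Lemma deviation_sphere0 x : punctured x -> X (0, x) = 0.
Proof.
move=> x0; rewrite /deviation /= F0; last exact: to_sphereP.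
rewrite /to_sphere scalerA mulrA divfK ?gt_eqF// divff ?gt_eqF ?nrm_gt0//.
by rewrite scale1r subrr.
Qed.

Lemma extension_domain0 x : punctured x -> D (0, x).
Proof. by move=> x0; split=> //; apply/US/to_sphereP. Qed.

Lemma partial_deviation_at0 x v : punctured x -> 'd X (0, x) (0, v) = 0.
Proof.
move=> x0.
have /differentiableP dX : differentiable X (0, x).
  by have [dX _] := smooth_deviation r oU cF 1%N; apply/dX/extension_domain0.
have di : is_diff x (fun y => (0, y)) (fun v : E => (0, v) : R * E).
  exact: (is_diff_pair (is_diff_cst 0 x) (is_diff_id x)).
have [dXi dXE] : is_diff x (fun y => X (0, y)) (fun v : E => 'd X (0, x) (0, v)).
  exact: (is_diff_comp di dX).
have [_ E0] : is_diff x (fun y => X (0, y)) ('d (cst (0 : E)) x).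
  apply: (@near_is_diff _ _ _ (cst (0 : E)) (fun y => X (0, y))).
    have := open_nbhs_nbhs (conj (@open_punctured R n) x0).
    by apply: filterS => y y0; rewrite deviation_sphere0.
  exact: differentiable_cst.
have E1 : (fun v : E => 'd X (0, x) (0, v)) = (fun=> 0).
  by rewrite -dXE E0 diff_cst.
exact: (congr1 (fun h : E -> E => h v) E1).
Qed.

Lemma compact_real_sphere : compact (real_sphere r : set E).
Proof.
apply: bounded_closed_compact.
  exists r; split; first exact: num_real.
  move=> M rM x Sx /=; rewrite [leLHS]/Num.Def.normr/= mx_normrE.
  apply: (bigmax_le _ (ltW (lt_trans r0 rM)))  => -[i j] _ /=.
  rewrite (ord1 i) {i} (le_trans _ (ltW rM))//.
  rewrite -(@ler_pXn2r _ 2)// ?nnegrE ?(ltW r0)// -Sx real_normK ?num_real//.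
  rewrite -(splitK j); case: (fintype.split j) => k /=; rewrite (bigD1 k)//=.
    rewrite -[leLHS]addr0 lerD ?sumr_ge0// => [|i _]; last exact: sqmod_ge0.
    by rewrite lerDl sqr_ge0.
  rewrite -[leLHS]addr0 lerD ?sumr_ge0// => [|i _]; last exact: sqmod_ge0.
  by rewrite lerDr sqr_ge0.
rewrite (_ : real_sphere r = (fun x : E => \sum_j sqmod j x) @^-1` [set r ^+ 2]) //.
apply: closed_comp; last exact: closed_eq.
have cS : class_C 0 setT (fun x : E => \sum_j sqmod j x).
  by apply: class_C_sum; [exact: openT|move=> j _; exact: class_C_sqmod openT].
by move=> x _; exact: cS.
Qed.

(** At time 0 the deviation vanishes identically, so that its derivatives in x vanish
    as well; they are continuous and the sphere is compact. *)
Lemma partial_deviation_small : \forall e \near (0 : R), forall x, real_sphere r x ->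
  D (e, x) /\ forall v, `|'d X (e, x) (0, v)| <= 2^-1 * `|v|.
Proof.
pose d := 2^-1 / (n + n).+1%:R : R.
have d0 : 0 < d by rewrite divr_gt0.
have dlt : (n + n)%:R * d <= 2^-1.
  by rewrite /d mulrCA ler_piMr// ler_pdivrMr// mul1r ler_nat.
apply: filterS (near_compact_tube (P := fun q : R * E => D q /\
   forall i, `|'d X q (0, delta_mx 0 i)| < d) compact_real_sphere _) => [e eP x Sx|x Sx].
  have [De dX] := eP x Sx; split=> // v.
  have -> : (0, v) = \sum_i v 0 i *: (0, delta_mx 0 i) :> R * E.
    rewrite {1}[v]row_sum_delta; elim/big_rec2: _ => // i a b _ <-.
    by apply: injective_projections; rewrite /= ?scaler0 ?add0r.
  rewrite linear_sum; apply: (le_trans (ler_norm_sum _ _ _)).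
  apply: (@le_trans _ _ (\sum_(i < n + n) d * `|v|)).
    apply: ler_sum => i _; rewrite linearZ normrZ mulrC ler_pM// ?(ltW (dX i))//.
    rewrite [leRHS]/Num.Def.normr/= mx_normrE.
    exact: (le_bigmax _ (fun k => `|v k.1 k.2|) (0, i)).
  by rewrite sumr_const card_ord -[leLHS]mulr_natl mulrA ler_wpM2r.
have x0 := sphere_punctured r0 Sx; have D0 := extension_domain0 x0.
apply: filterI; first by apply: open_nbhs_nbhs; split=> //; exact: extension_domain_open.
apply: (@filter_forall _ _ (fun i (q : R * E) => `|'d X q (0, delta_mx 0 i)| < d)
  (nbhs ((0, x) : R * E))) => i.
have [_ /(_ (0, delta_mx 0 i)) cX] := smooth_deviation r oU cF 1%N.
exact: (continuous_near_small d0 (cX _ D0) (partial_deviation_at0 (delta_mx 0 i) x0)).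
Qed.

Section FixedParameter.
Variable e : R.
Hypothesis De : forall x, real_sphere r x -> D (e, x).
Hypothesis De' : forall x v, real_sphere r x -> `|'d X (e, x) (0, v)| <= 2^-1 * `|v|.
Let Y x := X (e, x).

Lemma deviationZ c x : 0 < c -> punctured x -> Y (c *: x) = c *: Y x.
Proof.
move=> c0 x0; rewrite /Y /deviation /= to_sphereZ// nrmZ ?(ltW c0)//.
by rewrite scalerBr scalerA mulrA.
Qed.

Lemma extension_domain_all x : punctured x -> D (e, x).
Proof.
move=> x0; have /De [_] := to_sphereP r0 x0; rewrite /preimage /= => H; split=> //.
by rewrite /preimage /= -[to_sphere r x](to_sphere_id r0)//; exact: to_sphereP.
Qed.

Lemma smooth_deviation_at : class_Coo punctured Y.
Proof.
move=> m; apply: (@class_C_comp _ _ _ _ m punctured D (fun x => (e, x)) X) => //.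
- by apply: finite_basis_prod; [exact: finite_basis_real|exact: finite_basis_rV].
- exact: finite_basis_rV.
- exact: open_punctured.
- exact: extension_domain_open.
- exact: extension_domain_all.
- apply: class_C_pair; [exact: open_punctured|exact: class_C_cst|exact: class_C_id].
- exact: smooth_deviation.
Qed.

Lemma differentiable_deviation_at x : punctured x -> differentiable Y x.
Proof. by have [dY _] := smooth_deviation_at 1%N; exact: dY. Qed.

(** The derivative of a map that is homogeneous of degree 1 is homogeneous of
    degree 0, hence the bound on the sphere holds everywhere. *)
Lemma diff_deviation_bound x v : punctured x -> `|'d Y x v| <= 2^-1 * `|v|.
Proof.
move=> x0; have Sx := to_sphereP r0 x0; set c := r / nrm x.
have c0 : 0 < c by rewrite divr_gt0// nrm_gt0.
have y0 := sphere_punctured r0 Sx.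
have /differentiableP dY := differentiable_deviation_at y0.
have dc : is_diff x (fun y : E => c *: y) (fun y : E => c *: y) by exact: is_diff_scaler.
have dYc : is_diff x (fun y => Y (c *: y)) (fun v => 'd Y (to_sphere r x) (c *: v)).
  exact: (is_diff_comp dc dY).
have [dcY dcYE] : is_diff x (fun y => c^-1 *: Y (c *: y))
    (fun v => c^-1 *: 'd Y (to_sphere r x) (c *: v)).
  exact: (is_diff_comp dYc (is_diff_scaler _ _)).
have [_ E1] : is_diff x Y ('d (fun y => c^-1 *: Y (c *: y)) x).
  apply: near_is_diff dcY.
  have := open_nbhs_nbhs (conj (@open_punctured R n) x0).
  by apply: filterS => y y0'; rewrite deviationZ// scalerK// gt_eqF.
have [_ E2] : is_diff (to_sphere r x) Y (fun v => 'd X (e, to_sphere r x) (0, v)).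
  have di : is_diff (to_sphere r x) (fun y => (e, y)) (fun v : E => (0, v) : R * E).
    exact: (is_diff_pair (is_diff_cst e _) (is_diff_id _)).
  have /differentiableP dX : differentiable X (e, to_sphere r x).
    by have [dX _] := smooth_deviation r oU cF 1%N; apply/dX/De.
  exact: (is_diff_comp di dX).
have E3 : 'd Y x v = c^-1 *: 'd Y (to_sphere r x) (c *: v).
  have E3 := f_equal (fun h : E -> E => h v) (etrans E1 dcYE); exact E3.
have E4 : 'd Y (to_sphere r x) (c *: v) = c *: 'd Y (to_sphere r x) v by exact: linearZ.
have E5 : 'd Y (to_sphere r x) v = 'd X (e, to_sphere r x) (0, v).
  have E5 := f_equal (fun h : E -> E => h v) E2; exact E5.
have E6 := etrans (congr1 (fun w => c^-1 *: w) E4) (scalerK (lt0r_neq0 c0) _).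
by rewrite (etrans E3 (etrans E6 E5)); exact: De'.
Qed.

Lemma deviation_at0 : Y 0 = 0.
Proof. by rewrite /Y /deviation /= nrm0 mul0r scale0r subrr. Qed.

Lemma deviation_norm x : `|Y x| <= 2^-1 * `|x|.
Proof.
have [->|x0] := eqVneq x 0; first by rewrite deviation_at0 !normr0 mulr0.
(* Y (x / 2) is half of Y x, so that the mean value bound between x / 2 and x suffices *)
have : `|Y x - Y (2^-1 *: x)| <= 2^-1 * `|x - 2^-1 *: x|.
  apply: mean_value_bound => t /andP[t0 t1].
  have xt : punctured (2^-1 *: x + t *: (x - 2^-1 *: x)).
    have -> : 2^-1 *: x + t *: (x - 2^-1 *: x) = (2^-1 + t / 2) *: x.
      by apply/rowP => i; rewrite !mxE; field.
    by apply/negP; rewrite scaler_eq0 (negPf x0) orbF gt_eqF//; lra.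
  by split; [exact: differentiable_deviation_at|exact: diff_deviation_bound].
rewrite deviationZ ?invr_gt0//.
have half (z : E) : z - 2^-1 *: z = 2^-1 *: z by apply/rowP => i; rewrite !mxE; field.
by rewrite !half !normrZ gtr0_norm ?invr_gt0// ler_pM2l ?invr_gt0.
Qed.

(** On a segment through the origin, where the deviation need not be differentiable,
    |x - y| = |x| + |y| and the bound on the norm is enough. *)
Lemma deviation_lipschitz x y : `|Y x - Y y| <= 2^-1 * `|x - y|.
Proof.
have [[t [/andP[t0 t1] t00]]|H] :=
    pselect (exists t : R, 0 <= t <= 1 /\ y + t *: (x - y) = 0).
  have -> : `|x - y| = `|x| + `|y|.
    have yE : y = - t *: (x - y) by rewrite scaleNr; apply/eqP; rewrite -addr_eq0 t00.
    have xE : x = (1 - t) *: (x - y) by rewrite scalerBl scale1r -[LHS](subrK y) {2}yE scaleNr.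
    rewrite {2}xE {3}yE !normrZ normrN !ger0_norm ?subr_ge0//; ring.
  by rewrite (le_trans (ler_normB _ _))// mulrDr lerD// deviation_norm.
apply: mean_value_bound => t t01.
have xt : punctured (y + t *: (x - y)) by apply/eqP => t00; apply: H; exists t.
by split; [exact: differentiable_deviation_at|exact: diff_deviation_bound].
Qed.

Let f x := x + Y x.

Lemma extension_sphere x : real_sphere r x -> f x = F (e, x).
Proof.
move=> Sx; rewrite /f /Y /deviation /= to_sphere_id//.
by have /(nrm_eq _ r0) -> := Sx; rewrite divff ?gt_eqF// scale1r addrC subrK.
Qed.

Lemma extension_expands x y : `|x - y| <= 2 * `|f x - f y|.
Proof.
have := deviation_lipschitz x y.
have : `|x - y| <= `|f x - f y| + `|Y x - Y y|.
  have {1}-> : x - y = (f x - f y) - (Y x - Y y) by apply/rowP => i; rewrite !mxE; ring.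
  exact: ler_normB.
lra.
Qed.

Lemma nrm_extension x : punctured x -> nrm (f x) = nrm x.
Proof.
move=> x0; have nx := nrm_gt0 x0.
have -> : f x = (nrm x / r) *: F (e, to_sphere r x).
  by rewrite /f /Y /deviation /= addrC subrK.
rewrite nrmZ ?divr_ge0 ?ltW//.
have [_ /FS/(_ (to_sphereP r0 x0))/(nrm_eq _ r0) ->] := extension_domain_all x0.
by rewrite divfK// gt_eqF.
Qed.

(** The homogeneous extension f = id + Y of F(e, -) is a bijection of the whole space,
    because Y is a contraction, and it preserves the Euclidean norm. Its derivative
    is injective for the same reason, so that its inverse is smooth off the origin. *)
Lemma perturbed_sphere_diffeo : exists psi phi : E -> E,
  [/\ smooth_near (real_sphere r) psi, smooth_near (real_sphere r) phi,
      forall x, real_sphere r x -> psi x = F (e, x) &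
      forall x, real_sphere r x -> real_sphere r (phi x) /\
        psi (phi x) = x /\ phi (psi x) = x].
Proof.
have [g gP] := choice (contraction_perturbation_onto deviation_at0 deviation_lipschitz).
have fK y : f (g y) = y by exact: gP.
have gK x : g (f x) = x.
  apply/eqP; rewrite -subr_eq0 -normr_le0; have := extension_expands (g (f x)) x.
  by rewrite fK subrr normr0 mulr0.
have f0 x : punctured x -> punctured (f x).
  move=> x0; apply/eqP => fx; have := nrm_extension x0; rewrite fx nrm0 => E0.
  by have := nrm_gt0 x0; rewrite -E0 ltxx.
have g0 x : punctured x -> punctured (g x).
  move=> /eqP x0; apply/eqP => gx; apply: x0.
  by rewrite -(fK x) gx /f deviation_at0 addr0.
have cf : class_Coo punctured f.
  move=> m; apply: class_CD; [exact: open_punctured|exact: class_C_id|exact: smooth_deviation_at].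
have cg : class_Coo punctured g.
  apply: (smooth_inverse (@open_punctured R n) (@open_punctured R n) cf g0 (fun y _ => fK y)).
  - move=> y _; apply: (@lipschitz_continuous _ _ _ _ 2) => u v.
    by have := extension_expands (g u) (g v); rewrite !fK.
  - move=> y v /g0 y0.
    have /differentiableP dY := differentiable_deviation_at y0.
    have df : is_diff (g y) f (fun v => v + 'd Y (g y) v) by exact: is_diffD.
    rewrite diff_val => /eqP; rewrite addr_eq0 => /eqP vE.
    have := diff_deviation_bound v y0; rewrite -normrN -vE => H.
    by apply/eqP; rewrite -normr_le0; have := normr_ge0 v; lra.
exists f, g; split.
- by exists punctured; split=> //; [exact: open_punctured|move=> x; exact: sphere_punctured].
- by exists punctured; split=> //; [exact: open_punctured|move=> x; exact: sphere_punctured].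
- exact: extension_sphere.
- move=> x Sx; split; last by rewrite gK; split=> //; exact: fK.
  have x0 := sphere_punctured r0 Sx.
  apply/(nrm_eq _ r0); rewrite -(nrm_extension (g0 _ x0)) fK; exact/(nrm_eq _ r0).
Qed.

End FixedParameter.

(** A smooth family of self-maps of the sphere that starts at the identity consists of
    diffeomorphisms for small times. Extending the maps homogeneously puts the
    problem into a vector space, where a small Lipschitz perturbation of the identity
    is inverted by a fixed point argument. *)
Theorem sphere_perturbation : \forall e \near (0 : R),
  (forall x, real_sphere r x -> U (e, x)) /\
  exists psi phi : E -> E,
  [/\ smooth_near (real_sphere r) psi, smooth_near (real_sphere r) phi,
      forall x, real_sphere r x -> psi x = F (e, x) &
      forall x, real_sphere r x -> real_sphere r (phi x) /\
        psi (phi x) = x /\ phi (psi x) = x].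
Proof.
apply: filterS partial_deviation_small => e eP; split.
  by move=> x Sx; have [[_]] := eP x Sx; rewrite /preimage /= to_sphere_id.
apply: perturbed_sphere_diffeo => [x Sx|x v Sx]; first by have [] := eP x Sx.
by have [_] := eP x Sx; exact.
Qed.

End Perturbation.

(** * Complex-valued smooth functions and roots near 1 *)

Section ComplexCalculus.
Context {R : realType}.
Implicit Types V : normedModType R.

Definition complex_class_C V m (U : set V) (f : V -> R[i]) :=
  class_C m U (fun x => complex.Re (f x)) /\ class_C m U (fun x => complex.Im (f x)).

Lemma complex_class_C_cst V m (U : set V) (c : R[i]) : complex_class_C m U (fun=> c).
Proof. by split; exact: class_C_cst. Qed.

Lemma complex_class_C_real V m (U : set V) (f : V -> R) :
  class_C m U f -> complex_class_C m U (fun x => (f x)%:C).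
Proof. by move=> cf; split=> //=; exact: class_C_cst. Qed.

Lemma complex_class_CD V m (U : set V) (f g : V -> R[i]) : open U ->
  complex_class_C m U f -> complex_class_C m U g -> complex_class_C m U (fun x => f x + g x).
Proof.
move=> oU [rf jf] [rg jg]; split.
  rewrite (_ : (fun _ => _) = fun x => complex.Re (f x) + complex.Re (g x)).
    exact: class_CD.
  by apply/funext => x; case: (f x) (g x) => [? ?] [? ?].
rewrite (_ : (fun _ => _) = fun x => complex.Im (f x) + complex.Im (g x)).
  exact: class_CD.
by apply/funext => x; case: (f x) (g x) => [? ?] [? ?].
Qed.

Lemma complex_class_CM V m (U : set V) (f g : V -> R[i]) : open U ->
  complex_class_C m U f -> complex_class_C m U g -> complex_class_C m U (fun x => f x * g x).
Proof.
move=> oU [rf jf] [rg jg]; split.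
  rewrite (_ : (fun _ => _) = fun x => complex.Re (f x) * complex.Re (g x) -
                                     complex.Im (f x) * complex.Im (g x)).
    by apply: class_CB => //; exact: class_CM.
  by apply/funext => x; case: (f x) (g x) => [? ?] [? ?].
rewrite (_ : (fun _ => _) = fun x => complex.Re (f x) * complex.Im (g x) +
                                   complex.Im (f x) * complex.Re (g x)).
  by apply: class_CD => //; exact: class_CM.
by apply/funext => x; case: (f x) (g x) => [? ?] [? ?].
Qed.

Lemma complex_class_C_conj V m (U : set V) (f : V -> R[i]) : open U ->
  complex_class_C m U f -> complex_class_C m U (fun x => (f x)^*).
Proof.
move=> oU [rf jf]; split.
  rewrite (_ : (fun _ => _) = fun x => complex.Re (f x)) //.
  by apply/funext => x; case: (f x).
rewrite (_ : (fun _ => _) = fun x => - complex.Im (f x)); first exact: class_CN.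
by apply/funext => x; case: (f x).
Qed.

Lemma complex_class_CX V m (U : set V) (f : V -> R[i]) k : open U ->
  complex_class_C m U f -> complex_class_C m U (fun x => f x ^+ k).
Proof.
move=> oU cf; elim: k => [|k IH].
  by under eq_fun do rewrite expr0; exact: complex_class_C_cst.
rewrite (_ : (fun _ => _) = fun x => f x * f x ^+ k); first exact: complex_class_CM.
by apply/funext => x; rewrite exprS.
Qed.

Lemma complex_class_C_sum V m (U : set V) (I : Type) (s : seq I) (P : pred I)
    (f : I -> V -> R[i]) : open U -> (forall i, P i -> complex_class_C m U (f i)) ->
  complex_class_C m U (fun x => \sum_(i <- s | P i) f i x).
Proof.
move=> oU cf; elim: s => [|i s IH].
  rewrite (_ : (fun _ => _) = fun=> 0); first exact: complex_class_C_cst.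
  by apply/funext => x; rewrite big_nil.
have [Pi|Pi] := boolP (P i).
  rewrite (_ : (fun _ => _) = fun x => f i x + \sum_(j <- s | P j) f j x).
    by apply: complex_class_CD => //; exact: cf.
  by apply/funext => x; rewrite big_cons Pi.
rewrite (_ : (fun _ => _) = fun x => \sum_(j <- s | P j) f j x) //.
by apply/funext => x; rewrite big_cons (negPf Pi).
Qed.

Lemma class_C_normsq V m (U : set V) (f : V -> R[i]) : open U -> complex_class_C m U f ->
  class_C m U (fun x => complex.Re (f x) ^+ 2 + complex.Im (f x) ^+ 2).
Proof. by move=> oU [rf jf]; apply: class_CD => //; exact: class_CX. Qed.

End ComplexCalculus.

Section ComplexRoot.
Context {R : realType}.
Implicit Types (w : R[i]) (a b : nat).

Lemma realcM (x y : R) : (x * y)%:C = x%:C * y%:C.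
Proof. by rewrite rmorphM. Qed.

Lemma realcX (x : R) k : (x ^+ k)%:C = x%:C ^+ k.
Proof. by rewrite rmorphXn. Qed.

Lemma de_moivre (th : R) k :
  (cos th +i* sin th) ^+ k = cos (k%:R * th) +i* sin (k%:R * th).
Proof.
elim: k => [|k IH]; first by rewrite expr0 mul0r cos0 sin0.
rewrite exprS IH -natr1 mulrDl mul1r cosD sinD; apply/eqP; rewrite eq_complex /=.
by apply/andP; split; apply/eqP; ring.
Qed.

(** A solution zeta of zeta^a |zeta|^(2b) = w for w in the right half-plane, smooth in
    w and equal to 1 at w = 1, in polar coordinates. *)
Definition root_modulus a b w : R :=
  expR (ln (complex.Re w ^+ 2 + complex.Im w ^+ 2) / (2 * (a + 2 * b)%:R)).
Definition root_argument a w : R := atan (complex.Im w / complex.Re w) / a%:R.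
Definition mixed_root a b w : R[i] :=
  (root_modulus a b w)%:C * (cos (root_argument a w) +i* sin (root_argument a w)).

Lemma root_modulus_gt0 a b w : 0 < root_modulus a b w.
Proof. exact: expR_gt0. Qed.

Lemma mixed_root_normsq a b w :
  mixed_root a b w * (mixed_root a b w)^* = (root_modulus a b w ^+ 2)%:C.
Proof.
rewrite /mixed_root; set th := root_argument a w; set p := root_modulus a b w.
have := cos2Dsin2 th => cs.
apply/eqP; rewrite eq_complex /=; apply/andP; split; apply/eqP; last ring.
transitivity (p ^+ 2 * (cos th ^+ 2 + sin th ^+ 2)); first ring.
by rewrite cs mulr1.
Qed.

Lemma mixed_root_re_im a b w :
  complex.Re (mixed_root a b w) ^+ 2 + complex.Im (mixed_root a b w) ^+ 2 =
  root_modulus a b w ^+ 2.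
Proof.
have := congr1 (@complex.Re R) (mixed_root_normsq a b w).
by case: (mixed_root a b w) => u v /= <-; ring.
Qed.

Lemma mixed_rootP a b w : (0 < a)%N -> 0 < complex.Re w ->
  mixed_root a b w ^+ a * (mixed_root a b w * (mixed_root a b w)^*) ^+ b = w.
Proof.
move=> a0 w0; rewrite mixed_root_normsq /mixed_root exprMn de_moivre.
have an : a%:R != 0 :> R by rewrite pnatr_eq0 -lt0n.
rewrite /root_argument [a%:R * _]mulrC divfK//.
case: w w0 => x y /= x0; set s := x ^+ 2 + y ^+ 2.
have xn : x != 0 by rewrite gt_eqF.
have s0 : 0 < s by rewrite ltr_pwDl ?exprn_gt0// sqr_ge0.
set p := root_modulus _ _ _.
have pE : p ^+ a * (p ^+ 2) ^+ b = Num.sqrt s.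
  have abn : (a + 2 * b)%:R != 0 :> R by rewrite pnatr_eq0 addn_eq0 (gtn_eqF a0).
  have pp : 0 <= p ^+ (a + 2 * b) by rewrite exprn_ge0// ltW// root_modulus_gt0.
  rewrite -exprM -exprD; apply/eqP; rewrite -(@eqrXn2 _ 2) ?sqrtr_ge0//.
  rewrite sqr_sqrtr ?(ltW s0)// -exprM /p /root_modulus -expRM_natl /= -/s natrM.
  move: (a + 2 * b)%:R abn => A abn.
  have -> : A * 2 * (ln s / (2 * A)) = ln s by field.
  by rewrite lnK.
have sE : Num.sqrt (1 + (y / x) ^+ 2) = Num.sqrt s / x.
  have -> : 1 + (y / x) ^+ 2 = s / x ^+ 2 by rewrite /s; field.
  by rewrite sqrtrM ?ltW// -exprVn sqrtr_sqr gtr0_norm// invr_gt0.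
have ss0 : Num.sqrt s != 0 by rewrite gt_eqF// sqrtr_gt0.
have cE : cos (atan (y / x)) = x / Num.sqrt s.
  by rewrite cos_atan sE invf_div.
have sinE : sin (atan (y / x)) = y / Num.sqrt s.
  have tE := atanK (y / x); rewrite /tan cE in tE.
  rewrite -[LHS](@divfK _ (x / Num.sqrt s)) ?mulf_neq0 ?invr_eq0// tE; field.
  by rewrite ss0 xn.
have -> : p%:C ^+ a * (cos (atan (y / x)) +i* sin (atan (y / x))) * (p ^+ 2)%:C ^+ b =
    (p ^+ a * (p ^+ 2) ^+ b)%:C * (cos (atan (y / x)) +i* sin (atan (y / x))).
  by rewrite realcM !realcX mulrAC.
rewrite pE cE sinE; apply/eqP; rewrite eq_complex /=; apply/andP; split; apply/eqP.
  by rewrite mul0r subr0 mulrC divfK.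
by rewrite mul0r addr0 mulrC divfK.
Qed.

Lemma mixed_root1 a b : mixed_root a b 1 = 1.
Proof.
rewrite /mixed_root /root_modulus /root_argument /= expr1n expr0n addr0 ln1 mul0r.
by rewrite expR0 mul0r atan0 mul0r cos0 sin0 mulr1.
Qed.

Lemma class_C_mixed_root (V : normedModType R) m (U : set V) a b (f : V -> R[i]) : open U ->
  (forall x, U x -> 0 < complex.Re (f x)) -> complex_class_C m U f ->
  complex_class_C m U (fun x => mixed_root a b (f x)).
Proof.
move=> oU f0 cf; have [rf jf] := cf.
apply: complex_class_CM => //.
  apply: complex_class_C_real; rewrite /root_modulus.
  apply: (@class_C_comp_function _ _ m _ setT _ expR) => //; last exact: class_C_expR openT.
  apply: class_CM => //; last exact: class_C_cst.
  apply: (@class_C_comp_function _ _ m _ [set u : R | 0 < u]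
    (fun x => complex.Re (f x) ^+ 2 + complex.Im (f x) ^+ 2) (@ln R)) => //; last exact: class_C_ln.
    by move=> x /f0 fx; rewrite /= ltr_pwDl ?exprn_gt0// sqr_ge0.
  exact: class_C_normsq.
have cth : class_C m U (fun x => root_argument a (f x)).
  rewrite /root_argument; apply: class_CM => //; last exact: class_C_cst.
  apply: (@class_C_comp_function _ _ m _ setT (fun x => complex.Im (f x) / complex.Re (f x)) (@atan R)) => //; last exact: class_C_atan openT.
  apply: class_CM => //; apply: class_CV => //.
  by move=> x /f0/lt0r_neq0.
have [cs cc] := class_C_sin_cos m (@openT R).
by split=> /=; [exact: (@class_C_comp_function _ _ m _ setT (fun x => root_argument a (f x)) (@cos R))|
  exact: (@class_C_comp_function _ _ m _ setT (fun x => root_argument a (f x)) (@sin R))].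
Qed.

End ComplexRoot.

(** * Right inverses supported on maximal minors *)

Section Minors.
Local Open Scope nat_scope.

Lemma increasing_enumeration n k (T : {set 'I_n}) : #|T| = k ->
  exists s : 'I_k -> 'I_n, [/\ {homo s : i j / i < j}, injective s & forall j, (j \in T) = (j \in codom s)].
Proof.
move=> cT; pose s (l : 'I_k) := enum_val (cast_ord (esym cT) l).
have sT : sorted (relpre (val : 'I_n -> nat) ltn) (enum T).
  rewrite {1}/(enum _) -enumT /=; apply: sorted_filter; first by move=> ? ? ?; exact: ltn_trans.
  by rewrite -sorted_map val_enum_ord iota_ltn_sorted.
exists s; split.
- move=> i j ij; rewrite /s.
  have x0 : 'I_n := s i.
  rewrite !(enum_val_nth x0).
  apply: (sorted_ltn_nth (leT := relpre (val : 'I_n -> nat) ltn)) => //=.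
  + by move=> ? ? ?; exact: ltn_trans.
  + by rewrite inE -cardE cT.
  + by rewrite inE -cardE cT.
- by move=> i j /enum_val_inj/cast_ord_inj.
- move=> j; apply/idP/codomP => [jT|[l ->]]; last exact: enum_valP.
  exists (cast_ord cT (enum_rank_in jT j)).
  by rewrite /s cast_ordK enum_rankK_in.
Qed.

(** List the elements of J first, then the others, and take the first k. *)
Lemma comparable_subset n k (J : {set 'I_n}) : k <= n ->
  exists2 T : {set 'I_n}, #|T| = k & (T \subset J) || (J \subset T).
Proof.
move=> kn; pose e := take k (enum J ++ enum (~: J)).
have ue : uniq (enum J ++ enum (~: J)).
  rewrite cat_uniq !enum_uniq andbT /=; apply/hasPn => x.
  by rewrite !mem_enum inE.
have se : size (enum J ++ enum (~: J)) = n by rewrite size_cat -!cardE cardsC card_ord.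
exists [set x in e].
  rewrite cardsE (card_uniqP _) ?take_uniq// size_take se.
  by move: kn; rewrite leq_eqVlt => /predU1P[->|->]//; rewrite ltnn.
have [kJ|Jk] := leqP k #|J|; apply/orP; [left|right]; apply/fintype.subsetP => x.
  rewrite inE /e take_cat -cardE.
  move: kJ; rewrite leq_eqVlt => /predU1P[->|->].
    by rewrite ltnn subnn take0 cats0 mem_enum.
  by move=> /mem_take; rewrite mem_enum.
by move=> xJ; rewrite inE /e take_cat -cardE ltnNge (ltnW Jk) /= mem_cat mem_enum xJ.
Qed.

End Minors.

Section RightInverses.
Context {F : fieldType} {n k : nat}.
Variable Lam : 'M[F]_(k, n).
Hypothesis hLam : forall s : 'I_k -> 'I_n, {homo s : i j / (i < j)%N} ->
  \det (colsub s Lam) != 0.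

Lemma colsub_unit (s : 'I_k -> 'I_n) : {homo s : i j / (i < j)%N} -> colsub s Lam \in unitmx.
Proof. by move=> /hLam; rewrite unitmxE unitfE. Qed.

(** The inverse of the minor s, completed by zero rows. *)
Lemma supported_right_inverse (s : 'I_k -> 'I_n) : {homo s : i j / (i < j)%N} ->
  exists K : 'M[F]_(n, k), Lam *m K = 1%:M /\
    forall j i, (forall l, s l != j) -> K j i = 0.
Proof.
move=> /colsub_unit us.
exists (\matrix_(j < n, l < k) (s l == j)%:R *m invmx (colsub s Lam)); split.
  rewrite mulmxA (_ : Lam *m _ = colsub s Lam) ?mulmxV//.
  apply/matrixP => i l; rewrite !mxE (bigD1 (s l))//= mxE eqxx mulr1.
  by rewrite big1 ?addr0// => j jl; rewrite mxE eq_sym (negPf jl) mulr0.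
move=> j i sj; rewrite mxE big1// => l _.
by rewrite mxE (negPf (sj l)) mul0r.
Qed.

(** Otherwise the nonzero coordinates of u are contained in the range of some s, and
    form a kernel vector of the invertible minor s. *)
Lemma kernel_support (u : 'I_n -> F) : (k <= n)%N ->
  (forall i, \sum_j Lam i j * u j = 0) -> (exists j, u j != 0) ->
  exists2 s : 'I_k -> 'I_n, {homo s : i j / (i < j)%N} & forall l, u (s l) != 0.
Proof.
move=> kn Lu [j0 uj0]; pose J := [set j | u j != 0]%SET.
have [T cT TJ] := comparable_subset J kn.
have [s [hs si sT]] := increasing_enumeration cT.
exists s => // l; case/orP: TJ => [/fintype.subsetP TJ|/fintype.subsetP JT].
  by have := TJ (s l); rewrite sT codom_f inE; exact.
have uz j : j \notin T -> u j = 0.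
  by move=> jT; apply/eqP; apply: contraNT jT => uj; apply: JT; rewrite inE.
pose v : 'cV[F]_k := \col_l u (s l).
have v0 : v = 0.
  rewrite -[v](mulKmx (colsub_unit hs)) (_ : colsub s Lam *m v = 0) ?mulmx0//.
  apply/colP => i; rewrite !mxE -[RHS](Lu i) (bigID (fun j => j \in T))/=.
  rewrite [X in _ = _ + X]big1 ?addr0 => [|j /uz ->]; last by rewrite mulr0.
  rewrite (eq_bigl (mem (codom s))) => [|j]; last by rewrite sT.
  rewrite (eq_bigl (fun j => j \in [set s l | l in 'I_k]%SET)) => [|j]; last first.
    by apply/codomP/imsetP => [[l' ->]|[l' _ ->]]; exists l'.
  rewrite big_imset /=; last by move=> ? ? _ _; exact: si.
  by apply: eq_big => // l' _; rewrite !mxE.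
have : j0 \in codom s by rewrite -sT; apply: JT; rewrite inE.
move=> /codomP[l' j0E]; move: uj0; rewrite j0E.
by have := congr1 (fun w : 'cV[F]_k => w l' 0) v0; rewrite !mxE => ->; rewrite eqxx.
Qed.

End RightInverses.

(** * The correction of the monomials at time 0 *)

Section Correction.
Context {R : realType} {n k : nat}.
Local Notation E := 'rV[R]_(n + n).
Implicit Types (x y : E) (q : R * E) (s : {ffun 'I_k -> 'I_n}).
Variables (Lam : 'M[R[i]]_(k, n)) (a b : 'I_n -> nat).
Hypotheses (a0 : forall j, (0 < a j)%N) (kn : (k <= n)%N)
  (hLam : all_maximal_minors_nonzero Lam).

Definition normsq (c : R[i]) : R := complex.Re c ^+ 2 + complex.Im c ^+ 2.

Lemma normsqE (c : R[i]) : c * c^* = (normsq c)%:C.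
Proof.
case: c => u v; apply/eqP; rewrite eq_complex /normsq /=.
by apply/andP; split; apply/eqP; ring.
Qed.

Lemma normsq_ge0 c : 0 <= normsq c.
Proof. by rewrite addr_ge0 ?sqr_ge0. Qed.

Lemma normsq_eq0 c : (normsq c == 0) = (c == 0).
Proof. by rewrite paddr_eq0 ?sqr_ge0// !sqrf_eq0 eq_complex. Qed.

Lemma normsqZ (t : R) c : normsq (t%:C * c) = t ^+ 2 * normsq c.
Proof. by case: c => u v; rewrite /normsq /=; ring. Qed.

Lemma normsq_complexify_coord j x : normsq (complexify x 0 j) = sqmod j x.
Proof. by rewrite complexify_coord. Qed.

(** The equations at time q.1 are affine in the time: linear in the monomials at
    time 0, plus the time multiplied by the velocity. *)
Definition monomial j x : R[i] := complexify x 0 j ^+ a j * (sqmod j x ^+ b j)%:C.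
Definition equation q i : R[i] :=
  \sum_j Lam i j * (complexify q.2 0 j ^+ a j * ((1 - q.1) * sqmod j q.2 ^+ b j + q.1)%:C).
Definition velocity x i : R[i] :=
  \sum_j Lam i j * (complexify x 0 j ^+ a j * (1 - sqmod j x ^+ b j)%:C).

Lemma hamm_deformation_equation q :
  hamm_deformation Lam a b q.1 (complexify q.2) = \row_i equation q i.
Proof. by rewrite hamm_deformationE weighted_hammE. Qed.

Lemma equationE q i :
  equation q i = \sum_j Lam i j * monomial j q.2 + q.1%:C * velocity q.2 i.
Proof.
rewrite /velocity mulr_sumr -big_split /=; apply: eq_bigr => j _.
rewrite [q.1%:C * _]mulrCA -mulrDr; congr (_ * _).
rewrite /monomial [q.1%:C * _]mulrCA -mulrDr -realcM; congr (_ * _).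
rewrite -(rmorphD (real_complex R)) /=; congr (_%:C); ring.
Qed.

Definition monomial_normsq j x : R := sqmod j x ^+ a j * (sqmod j x ^+ b j) ^+ 2.

Lemma monomial_normsqE j x :
  monomial j x * (monomial j x)^* = (monomial_normsq j x)%:C.
Proof.
rewrite /monomial /monomial_normsq rmorphM mulrACA rmorphXn /= -exprMn.
rewrite normsqE normsq_complexify_coord -realcX; set t := sqmod j x ^+ b j.
by rewrite (normsqE t%:C) -realcM /normsq /= expr0n addr0.
Qed.

Lemma monomial_normsq_ge0 j x : 0 <= monomial_normsq j x.
Proof. by rewrite mulr_ge0 ?exprn_ge0 ?sqr_ge0// sqmod_ge0. Qed.

Lemma monomial_eq0 j x : (monomial j x == 0) = (sqmod j x == 0).
Proof.
apply/idP/idP => [/eqP m0|/eqP s0].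
  have := monomial_normsqE j x; rewrite m0 mul0r.
  move=> /(congr1 (@complex.Re R))/= /esym/eqP.
  by rewrite /monomial_normsq !mulf_eq0 !expf_eq0 /= => /orP[] => [/andP[]|/orP[/andP[]|/andP[]]].
have : complexify x 0 j == 0 by rewrite -normsq_eq0 normsq_complexify_coord s0.
by move=> /eqP z0; rewrite /monomial z0 expr0n (gtn_eqF (a0 j)) mul0r.
Qed.

Definition increasing s := [forall i : 'I_k, forall j : 'I_k, (i < j)%N ==> (s i < s j)%N].

Lemma increasingP s : reflect {homo s : i j / (i < j)%N} (increasing s).
Proof.
apply: (iffP forallP) => [H i j ij|H i]; first by have /forallP/(_ j)/implyP := H i; exact.
by apply/forallP => j; apply/implyP; exact: H.
Qed.

Lemma increasing_inj s : increasing s -> injective s.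
Proof.
move=> /increasingP hs i j sij; apply/val_inj/eqP => /=.
by case: ltngtP => // /hs; rewrite sij ltnn.
Qed.

Lemma right_inverse_family : exists K : {ffun 'I_k -> 'I_n} -> 'M[R[i]]_(n, k),
  forall s, increasing s -> Lam *m K s = 1%:M /\
    forall j i, (forall l, s l != j) -> K s j i = 0.
Proof.
have ex s : exists K : 'M[R[i]]_(n, k), increasing s -> Lam *m K = 1%:M /\
    forall j i, (forall l, s l != j) -> K j i = 0.
  case: (boolP (increasing s)) => [/increasingP hs|_]; last by exists 0.
  by have [K HK] := supported_right_inverse hLam hs; exists K.
by have [K HK] := choice ex; exists K.
Qed.

Variable K : {ffun 'I_k -> 'I_n} -> 'M[R[i]]_(n, k).
Hypothesis HK : forall s, increasing s -> Lam *m K s = 1%:M /\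
    forall j i, (forall l, s l != j) -> K s j i = 0.

(** The right inverses K s of Lam, averaged with the weights weight s / total_weight,
    form an exact right inverse at the zeros of the equations; the second term of the
    denominator keeps it positive where all the weights vanish. *)
Definition weight s x : R := \prod_l monomial_normsq (s l) x.
Definition equation_normsq q : R := \sum_i normsq (equation q i).
Definition velocity_normsq x : R := \sum_i normsq (velocity x i).
Definition total_weight q : R := \sum_(s | increasing s) weight s q.2 + equation_normsq q.

(** Division of the s-part of the correction by the j-th monomial is possible
    because the weight of s contains its squared modulus. *)
Definition relative_correction j q : R[i] :=
  (monomial j q.2)^* *
  (\sum_(s | increasing s) (\prod_(l | s l != j) monomial_normsq (s l) q.2)%:C *
     (\sum_i K s j i * velocity q.2 i)) * (q.1 / total_weight q)%:C.

Lemma monomial_correction j q : monomial j q.2 * relative_correction j q =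
  (\sum_(s | increasing s) (weight s q.2)%:C * (\sum_i K s j i * velocity q.2 i)) *
    (q.1 / total_weight q)%:C.
Proof.
rewrite /relative_correction !mulrA monomial_normsqE; congr (_ * _).
rewrite mulr_sumr; apply: eq_bigr => s hs; rewrite mulrA -realcM.
have [[l sl]|nsl] := pselect (exists l, s l = j).
  congr (_%:C * _); rewrite /weight [RHS](bigD1 l)//= sl; congr (_ * _).
  by apply: eq_bigl => l'; rewrite -sl (inj_eq (increasing_inj hs)).
have [_ K0] := HK hs.
rewrite [\sum_i _]big1 ?mulr0// => i _; rewrite K0 ?mul0r// => l.
by apply/eqP => sl; apply: nsl; exists l.
Qed.

(** Corrected by an exact right inverse, the monomials would satisfy at time 0 the
    equations that hold at time q.1. The average of the K s falls short of a right
    inverse by the factor 1 - equation_normsq / total_weight, which leaves a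
    defect of second order in the equations. *)
Lemma corrected_equation q i : total_weight q != 0 ->
  \sum_j Lam i j * (monomial j q.2 * (1 + relative_correction j q)) =
  equation q i - (q.1 * equation_normsq q / total_weight q)%:C * velocity q.2 i.
Proof.
move=> W0; rewrite equationE.
under eq_bigr do rewrite mulrDr mulr1 monomial_correction mulrDr.
rewrite big_split /= -addrA; congr (_ + _).
have -> : \sum_j Lam i j * ((\sum_(s | increasing s) (weight s q.2)%:C *
      (\sum_i K s j i * velocity q.2 i)) * (q.1 / total_weight q)%:C) =
    (\sum_(s | increasing s) (weight s q.2)%:C * velocity q.2 i) * (q.1 / total_weight q)%:C.
  under [LHS]eq_bigr do rewrite mulrA; rewrite -[LHS]mulr_suml; congr (_ * _).
  under [LHS]eq_bigr do rewrite mulr_sumr; rewrite [LHS]exchange_big /=.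
  apply: eq_bigr => s hs; under [LHS]eq_bigr do rewrite mulrCA.
  rewrite -[LHS]mulr_sumr; congr (_ * _).
  have [LK _] := HK hs.
  have -> : \sum_j Lam i j * (\sum_i0 K s j i0 * velocity q.2 i0) =
      \sum_i0 (Lam *m K s) i i0 * velocity q.2 i0.
    under [RHS]eq_bigr do rewrite mxE mulr_suml.
    rewrite exchange_big /=; apply: eq_bigr => j _; rewrite mulr_sumr.
    by apply: eq_bigr => i0 _; rewrite mulrA.
  rewrite LK (bigD1 i)//= mxE eqxx mul1r big1 ?addr0// => i0 ii0.
  by rewrite mxE eq_sym (negPf ii0) mul0r.
rewrite -mulr_suml -(rmorph_sum (real_complex R)) /= mulrAC -realcM -mulrBl.
rewrite -(rmorphB (real_complex R)) /=; congr (_%:C * _).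
have -> : \sum_(s | increasing s) weight s q.2 = total_weight q - equation_normsq q.
  by rewrite /total_weight addrK.
by field.
Qed.

Lemma weight_ge0 s x : 0 <= weight s x.
Proof. by rewrite prodr_ge0// => l _; exact: monomial_normsq_ge0. Qed.

Lemma equation_normsq_ge0 q : 0 <= equation_normsq q.
Proof. by rewrite sumr_ge0// => i _; exact: normsq_ge0. Qed.

(** If the equations hold at time 0, some increasing s selects nonzero monomials only,
    by [kernel_support], and its weight is positive. *)
Lemma total_weight_gt0 x : punctured x -> 0 < total_weight (0, x).
Proof.
move=> x0; rewrite /total_weight.
have w0 : 0 <= \sum_(s | increasing s) weight s x by rewrite sumr_ge0// => s _; exact: weight_ge0.
have [e0|e0] := eqVneq (equation_normsq (0, x)) 0; last first.
  by rewrite ltr_wpDl// lt_neqAle eq_sym e0 equation_normsq_ge0.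
rewrite e0 addr0.
have eq0 i : \sum_j Lam i j * monomial j x = 0.
  have : normsq (equation (0, x) i) == 0.
    move/eqP: e0; rewrite psumr_eq0 => [/allP H|i' _]; last exact: normsq_ge0.
    exact: (implyP (H i (mem_index_enum i))).
  by rewrite normsq_eq0 equationE /= mul0r addr0 => /eqP.
have [j sj] := sqmod_gt0 x0.
have [|s hs sm] := kernel_support hLam kn eq0.
  by exists j; rewrite monomial_eq0 gt_eqF.
have hs' : increasing (finfun s) by apply/increasingP => i i' ii'; rewrite !ffunE hs.
rewrite (bigD1 (finfun s))//= ltr_pwDl//.
  apply: prodr_gt0 => l _; rewrite ffunE.
  have := sm l; rewrite monomial_eq0 => sq0.
  by rewrite mulr_gt0// exprn_gt0// ?exprn_gt0// lt_neqAle eq_sym sq0 sqmod_ge0.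
by rewrite sumr_ge0// => t _; exact: weight_ge0.
Qed.

End Correction.

Section CorrectedPoint.
Context {R : realType} {n k : nat}.
Local Notation E := 'rV[R]_(n + n).
Implicit Types (x y : E) (q : R * E) (s : {ffun 'I_k -> 'I_n}).
Variables (Lam : 'M[R[i]]_(k, n)) (a b : 'I_n -> nat).
Hypotheses (a0 : forall j, (0 < a j)%N) (kn : (k <= n)%N)
  (hLam : all_maximal_minors_nonzero Lam).
Variable K : {ffun 'I_k -> 'I_n} -> 'M[R[i]]_(n, k).
Hypothesis HK : forall s, increasing s -> Lam *m K s = 1%:M /\
    forall j i, (forall l, s l != j) -> K s j i = 0.

Local Notation W := (total_weight Lam a b).
Local Notation xi := (relative_correction Lam a b K).
Local Notation u := (monomial a b).
Local Notation eqn := (equation Lam a b).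
Local Notation vel := (velocity Lam a b).
Local Notation eqn2 := (equation_normsq Lam a b).
Local Notation vel2 := (velocity_normsq Lam a b).

Section Smoothness.
Variables (m : nat) (U : set (R * E)).
Hypothesis oU : open U.

Lemma smooth_point : class_C m U (fun q : R * E => q.2).
Proof. by apply: (@class_C_snd _ _ _ _ m U id) => //; exact: class_C_id. Qed.

Lemma smooth_time : class_C m U (fun q : R * E => q.1).
Proof. by apply: (@class_C_fst _ _ _ _ m U id) => //; exact: class_C_id. Qed.

Lemma smooth_coordinate j : complex_class_C m U (fun q => complexify q.2 0 j).
Proof.
have c2 := smooth_point; split.
  rewrite (_ : (fun _ => _) = fun q : R * E => q.2 0 (lshift n j)).
    by apply: (@class_C_entry _ _ m U _ snd).
  by apply/funext => q; rewrite complexify_coord.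
rewrite (_ : (fun _ => _) = fun q : R * E => q.2 0 (rshift n j)).
  by apply: (@class_C_entry _ _ m U _ snd).
by apply/funext => q; rewrite complexify_coord.
Qed.

Lemma smooth_sqmod j : class_C m U (fun q => sqmod j q.2).
Proof.
apply: (@class_C_comp_real _ _ _ m U setT snd (sqmod j)) => //.
- exact: finite_basis_rV.
- exact: smooth_point.
- exact: class_C_sqmod openT.
Qed.

Lemma smooth_monomial j : complex_class_C m U (fun q => u j q.2).
Proof.
apply: complex_class_CM => //; first by apply: complex_class_CX => //; exact: smooth_coordinate.
by apply: complex_class_C_real; apply: class_CX => //; exact: smooth_sqmod.
Qed.

Lemma smooth_equation i : complex_class_C m U (eqn ^~ i).
Proof.
apply: complex_class_C_sum => // j _; apply: complex_class_CM => //; first exact: complex_class_C_cst.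
apply: complex_class_CM => //; first by apply: complex_class_CX => //; exact: smooth_coordinate.
apply: complex_class_C_real; apply: class_CD => //; last exact: smooth_time.
apply: class_CM => //; last by apply: class_CX => //; exact: smooth_sqmod.
by apply: class_CB => //; [exact: class_C_cst|exact: smooth_time].
Qed.

Lemma smooth_velocity i : complex_class_C m U (fun q => vel q.2 i).
Proof.
apply: complex_class_C_sum => // j _; apply: complex_class_CM => //; first exact: complex_class_C_cst.
apply: complex_class_CM => //; first by apply: complex_class_CX => //; exact: smooth_coordinate.
apply: complex_class_C_real; apply: class_CB => //; first exact: class_C_cst.
by apply: class_CX => //; exact: smooth_sqmod.
Qed.

Lemma smooth_monomial_normsq j : class_C m U (fun q => monomial_normsq a b j q.2).
Proof.
apply: class_CM => //; first by apply: class_CX => //; exact: smooth_sqmod.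
by apply: class_CX => //; apply: class_CX => //; exact: smooth_sqmod.
Qed.

Lemma smooth_equation_normsq : class_C m U eqn2.
Proof.
apply: class_C_sum => // i _.
exact: (class_C_normsq oU (smooth_equation i)).
Qed.

Lemma smooth_velocity_normsq : class_C m U (fun q => vel2 q.2).
Proof.
apply: class_C_sum => // i _.
exact: (class_C_normsq oU (smooth_velocity i)).
Qed.

Lemma smooth_total_weight : class_C m U W.
Proof.
apply: class_CD => //; last exact: smooth_equation_normsq.
apply: class_C_sum => // s _; apply: class_C_prod => // l _.
exact: smooth_monomial_normsq.
Qed.

Lemma smooth_relative_correction j : (forall q, U q -> W q != 0) ->
  complex_class_C m U (xi j).
Proof.
move=> W0; apply: complex_class_CM => //; last first.
  apply: complex_class_C_real; apply: class_CM => //; first exact: smooth_time.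
  by apply: class_CV => //; exact: smooth_total_weight.
apply: complex_class_CM => //; first by apply: complex_class_C_conj => //; exact: smooth_monomial.
apply: complex_class_C_sum => // s _; apply: complex_class_CM => //.
  by apply: complex_class_C_real; apply: class_C_prod => // l _; exact: smooth_monomial_normsq.
apply: complex_class_C_sum => // i _; apply: complex_class_CM => //; first exact: complex_class_C_cst.
exact: smooth_velocity.
Qed.

End Smoothness.

Definition positive_weight_domain : set (R * E) :=
  [set q | punctured q.2] `&` W @^-1` [set c | 0 < c].

(** Positivity of the real parts makes the roots available. The last condition, which
    holds for small times, prevents the defect of the corrected equations from
    compensating the equations. *)
Definition correction_domain : set (R * E) :=
  (positive_weight_domain `&` [set q | forall j, 0 < complex.Re (1 + xi j q)]) `&`
  (fun q => W q ^+ 2 - q.1 ^+ 2 * vel2 q.2 * eqn2 q) @^-1` [set c | 0 < c].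

Lemma open_positive_weight_domain : open positive_weight_domain.
Proof.
apply: open_preimage => //; first exact: punctured2_open.
by apply: class_C_continuous (smooth_total_weight 0 punctured2_open).
Qed.

Lemma smooth_shifted_correction m U j : open U -> U `<=` positive_weight_domain ->
  complex_class_C m U (fun q => 1 + xi j q).
Proof.
move=> oU UW; apply: complex_class_CD => //; first exact: complex_class_C_cst.
by apply: smooth_relative_correction => // q /UW[_ /lt0r_neq0].
Qed.

Lemma open_correction_domain : open correction_domain.
Proof.
have oW := open_positive_weight_domain.
have oR : open (positive_weight_domain `&` [set q | forall j, 0 < complex.Re (1 + xi j q)]).
  rewrite openE => q [Wq xq]; apply: filterI; first exact: open_nbhs_nbhs.
  apply: (@filter_forall _ _ (fun j q => 0 < complex.Re (1 + xi j q)) (nbhs (q : R * E))) => j.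
  have [cx _] := smooth_shifted_correction 0 j oW (fun _ => id).
  have /= := cx q Wq; move=> /cvgr_gt; apply; exact: xq.
apply: open_preimage => //.
have cW := smooth_total_weight 0 oR.
have ct := class_CX 2 oR (smooth_time 0 oR).
have cv := smooth_velocity_normsq 0 oR; have ce := smooth_equation_normsq 0 oR.
exact: class_C_continuous (class_CB oR (class_CX 2 oR cW) (class_CM oR (class_CM oR ct cv) ce)).
Qed.

Lemma correction_domain0 x : punctured x -> correction_domain (0, x).
Proof.
move=> x0; have W0 := total_weight_gt0 b a0 kn hLam x0.
split; last by rewrite /preimage /= expr0n !mul0r subr0 exprn_gt0.
split=> // j; rewrite /= /relative_correction /= mul0r mulr0 addr0.
exact: ltr01.
Qed.

(** This multiplier of z_j multiplies the j-th monomial by 1 + xi_j. *)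
Definition multiplier j q : R[i] := mixed_root (a j) (b j) (1 + xi j q).

Definition corrected q : E := realify (\row_j (multiplier j q * complexify q.2 0 j)).

Lemma complexify_corrected q j :
  complexify (corrected q) 0 j = multiplier j q * complexify q.2 0 j.
Proof. by rewrite realifyK mxE. Qed.

Lemma sqmod_corrected q j : sqmod j (corrected q) = normsq (multiplier j q) * sqmod j q.2.
Proof.
rewrite -!normsq_complexify_coord complexify_corrected.
by case: (multiplier j q) (complexify _ _ _) => ? ? [? ?]; rewrite /normsq /=; ring.
Qed.

Lemma normsq_multiplier_gt0 j q : 0 < normsq (multiplier j q).
Proof. by rewrite /normsq mixed_root_re_im exprn_gt0// root_modulus_gt0. Qed.

Lemma monomial_corrected q j : 0 < complex.Re (1 + xi j q) ->
  u j (corrected q) = u j q.2 * (1 + xi j q).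
Proof.
move=> x0; rewrite /monomial complexify_corrected sqmod_corrected.
have mP := mixed_rootP (b j) (a0 j) x0; rewrite -/(multiplier j q) normsqE in mP.
by rewrite -mP !exprMn !realcM !realcX; ring.
Qed.

Lemma smooth_corrected : class_Coo correction_domain corrected.
Proof.
move=> m; have oD := open_correction_domain.
have cz j : complex_class_C m correction_domain (fun q => multiplier j q * complexify q.2 0 j).
  apply: complex_class_CM => //; last exact: smooth_coordinate.
  apply: class_C_mixed_root => //; first by move=> q [[_ xq] _]; exact: xq.
  by apply: smooth_shifted_correction => // q [[]].
apply: class_C_rV => // i; rewrite -(splitK i).
case: (fintype.split i) => j /=; have [rz jz] := cz j.
  rewrite (_ : (fun _ => _) = fun q => complex.Re (multiplier j q * complexify q.2 0 j)) //.
  by apply/funext => q; rewrite /corrected /realify row_mxEl 2!mxE.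
rewrite (_ : (fun _ => _) = fun q => complex.Im (multiplier j q * complexify q.2 0 j)) //.
by apply/funext => q; rewrite /corrected /realify row_mxEr 2!mxE.
Qed.

Lemma corrected_punctured q : punctured q.2 -> punctured (corrected q).
Proof.
move=> /sqmod_gt0[j sj]; apply/eqP => c0.
have : 0 < sqmod j (corrected q) by rewrite sqmod_corrected mulr_gt0// normsq_multiplier_gt0.
by rewrite c0 /sqmod /re /im !mxE expr0n addr0 ltxx.
Qed.

Lemma corrected0 x : corrected (0, x) = x.
Proof.
apply: (can_inj (@complexifyK R n)); apply/rowP => j; rewrite complexify_corrected /multiplier /relative_correction /=.
by rewrite mul0r mulr0 addr0 mixed_root1 mul1r.
Qed.

(** If the corrected equations vanish, then eqn = (q.1 eqn2 / W) vel; comparing the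
    norms of both sides contradicts the last condition on the domain unless eqn = 0. *)
Lemma corrected_zero q : correction_domain q ->
  (forall i, eqn q i = 0) <-> (forall i, \sum_j Lam i j * u j (corrected q) = 0).
Proof.
move=> [[[_ W0] xq] sm].
have E0 i : \sum_j Lam i j * u j (corrected q) =
    eqn q i - (q.1 * eqn2 q / W q)%:C * vel q.2 i.
  rewrite -(corrected_equation HK); last by rewrite gt_eqF.
  by apply: eq_bigr => j _; rewrite monomial_corrected.
split=> [e0 i|e0].
  rewrite E0 e0 [eqn2 q]big1 ?mulr0 ?mul0r ?subr0// => i' _.
  by apply/eqP; rewrite normsq_eq0 e0.
have eE i : eqn q i = (q.1 * eqn2 q / W q)%:C * vel q.2 i.
  by apply/eqP; rewrite -subr_eq0 -E0 e0.
have e2 : eqn2 q = (q.1 * eqn2 q / W q) ^+ 2 * vel2 q.2.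
  by rewrite {1}/equation_normsq /velocity_normsq mulr_sumr; apply: eq_bigr => i _; rewrite eE normsqZ.
have [e20|e20] := eqVneq (eqn2 q) 0.
  by move=> i; rewrite eE e20 mulr0 mul0r mul0r.
have Wn : W q != 0 by rewrite gt_eqF.
exfalso; move: sm; rewrite /preimage /= => sm.
have : W q ^+ 2 - q.1 ^+ 2 * vel2 q.2 * eqn2 q = 0.
  apply: (mulIf e20); rewrite mul0r mulrBl {1}e2; field.
  by rewrite Wn.
by move=> H; move: sm; rewrite H ltxx.
Qed.

End CorrectedPoint.

(** * The deformation near time 0 and the theorem *)

Section DegenerateTime.
Context {R : realType} {n k : nat}.
Local Notation E := 'rV[R]_(n + n).
Implicit Types (x y : E) (q : R * E).
Variables (Lam : 'M[R[i]]_(k, n)) (a b : 'I_n -> nat).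
Hypotheses (a0 : forall j, (0 < a j)%N) (kn : (k <= n)%N)
  (hLam : all_maximal_minors_nonzero Lam).

Lemma profile01 (p : 'I_n -> nat) j (y m : R) :
  profile p (fun=> 0%N) (fun=> 0) (fun=> 1) j y m = m ^+ p j.
Proof. by rewrite /profile !mul0r add0r mul1r. Qed.

Lemma monomial_stretch (m : 'I_n -> R) x j :
  monomial a b j (stretch m x) = (m j ^+ (a j + 2 * b j))%:C * monomial a b j x.
Proof.
rewrite /monomial complexify_stretch sqmod_stretch exprMn.
rewrite [(_ * sqmod j x) ^+ _]exprMn -exprM exprD !realcM -(realcX (m j) (a j)); ring.
Qed.

(** At time 0 the map of [weighted_hamm_equiv] becomes z_j |z_j|^(2 b_j / a_j), up to
    scaling, which is not a diffeomorphism near z_j = 0 if b_j > 0. Instead the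
    correction adjusts the coordinates in terms of each other, in a way that depends
    smoothly on the time and is the identity at time 0; the weighted projection back
    to the sphere multiplies the equations at time 0, which are weighted homogeneous,
    by a positive number. *)
Lemma deformation_near_zero (r : R) : 0 < r -> exists e : R, [/\ 0 < e, e <= 1 &
  link_equiv r (hamm_deformation Lam a b e) (hamm_deformation Lam a b 0)].
Proof.
move=> r0; have [K HK] := right_inverse_family hLam.
pose p j := (a j + 2 * b j)%N.
have p0 j : (0 < p j)%N by rewrite addn_gt0 a0.
have c1 (j : 'I_n) : class_Coo punctured (fun _ : E => 1 : R) by move=> m; exact: class_C_cst.
have [s [mu [cmu [sP muP]]]] := @radial_projection R n r p (fun=> 0%N) (fun=> 0) (fun=> 1)
  (fun _ _ => 1) r0 p0 (fun=> lexx 0) (fun=> ltr01) c1 (fun _ _ _ => ltr01).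
pose pr y := stretch (mu ^~ y) y.
have oP := @open_punctured R n.
have cpr : class_Coo punctured pr by exact: smooth_stretch.
have prS y : punctured y -> real_sphere r (pr y).
  move=> y0; have [_ yE] := sP y y0.
  by rewrite /real_sphere /= -yE; apply: eq_bigr => j _; rewrite sqmod_stretch.
have pr_id y : real_sphere r y -> pr y = y.
  move=> Sy; have y0 := sphere_punctured r0 Sy; apply: stretch1 => j; apply: esym.
  apply: (@multipliers_unique _ _ p (fun=> 0%N) (fun=> 0) (fun=> 1) p0 (fun=> lexx 0)
    (fun=> ltr01) y (fun=> 1) (fun=> 1) (mu ^~ y) 1 (s y)) => //.
  - by move=> i; have [] := muP i y y0.
  - by move=> i; rewrite profile01 expr1n mulr1.
  - by move=> i; have [] := muP i y y0.
  - have [_ ->] := sP y y0; rewrite -Sy; apply: eq_bigr => i _.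
    by rewrite expr1n mul1r.
pose D := correction_domain Lam a b K.
have oD : open D by exact: open_correction_domain.
pose F q := pr (corrected Lam a b K q).
have D0 q : D q -> punctured (corrected Lam a b K q).
  by move=> [[[q0 _] _] _]; exact: corrected_punctured.
have cF : class_Coo D F.
  move=> m; apply: (@class_C_comp _ _ _ _ m D punctured (corrected Lam a b K) pr) => //.
  - exact: finite_basis_rV.
  - exact: finite_basis_rV.
  - exact: smooth_corrected.
have near_e := sphere_perturbation r0 oD cF.
have {near_e} [|||/= d d0 dP] := near_e.
- by move=> x Sx; apply: correction_domain0 => //; exact: sphere_punctured Sx.
- by move=> x Sx; rewrite /F corrected0 pr_id.
- by move=> q Dq _; apply/prS/D0.
pose e := Num.min 1 (d / 2).
have e0 : 0 < e by rewrite lt_min ltr01 divr_gt0.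
have ed : ball_ Num.norm 0 d e.
  rewrite /ball_ /= sub0r normrN gtr0_norm// gt_min; apply/orP; right.
  by rewrite ltr_pdivrMr// ltr_pMr// ltr1n.
have [De [psi [phi [cpsi cphi psiE phiP]]]] := dP e ed.
exists e; split=> //; first by rewrite ge_min lexx.
have psiS x : real_sphere r x -> real_sphere r (psi x).
  by move=> Sx; rewrite psiE//; apply/prS/D0/De.
exists psi, phi; split.
- by split.
- by move=> x Sx; split; [exact: psiS|have [_ []] := phiP x Sx].
- by move=> x Sx; have [? []] := phiP x Sx.
- move=> j x Sx; rewrite psiE// /F sqmod_stretch sqmod_corrected /=.
  have [m0 _] := muP j _ (D0 _ (De x Sx)).
  split=> [->|/eqP]; first by rewrite !mulr0.
  rewrite mulf_eq0 expf_eq0 (gt_eqF m0) /= mulf_eq0 => /orP[|/eqP//].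
  by rewrite (gt_eqF (normsq_multiplier_gt0 _ _ _ _ _ _)).
- move=> x Sx; have De' := De x Sx.
  have y0 := D0 _ De'; have [s0 _] := sP _ y0.
  set y := corrected Lam a b K (e, x) in y0 s0.
  have eqF i : equation Lam a b (0, psi x) i =
      (s y)%:C * \sum_j Lam i j * monomial a b j y.
    rewrite equationE mul0r addr0 psiE// mulr_sumr; apply: eq_bigr => j _.
    rewrite /= monomial_stretch mulrCA; congr (_%:C * _).
    by have [_] := muP j _ y0; rewrite profile01 mulr1.
  have eA : hamm_deformation Lam a b e (complexify x) = 0 <->
      (forall i, equation Lam a b (e, x) i = 0).
    rewrite (hamm_deformation_equation Lam a b (e, x)); split=> [H i|H].
      by have := congr1 (fun w : 'rV_k => w 0 i) H; rewrite !mxE.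
    by apply/rowP => i; rewrite !mxE.
  have eB : hamm_deformation Lam a b 0 (complexify (psi x)) = 0 <->
      (forall i, \sum_j Lam i j * monomial a b j y = 0).
    rewrite (hamm_deformation_equation Lam a b (0, psi x)); split=> [H i|H].
      have := congr1 (fun w : 'rV_k => w 0 i) H; rewrite !mxE eqF => /eqP.
      by rewrite mulf_eq0 eq_complex /= (gt_eqF s0) => /eqP.
    by apply/rowP => i; rewrite !mxE eqF H mulr0.
  exact: iff_trans eA (iff_trans (corrected_zero a0 HK De') (iff_sym eB)).
Qed.

End DegenerateTime.

Section Assembly.
Context {R : realType} {n k : nat}.
Implicit Types (H : 'rV[R[i]]_n -> 'rV[R[i]]_k) (z : 'rV[R[i]]_n).

Lemma sphere_realify (r : R) z : sphere r z <-> real_sphere r (realify z).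
Proof.
rewrite /sphere /real_sphere /=.
have -> : \sum_j `|z 0 j| ^+ 2 = (\sum_j sqmod j (realify z))%:C.
  rewrite (rmorph_sum (real_complex R)) /=; apply: eq_bigr => j _.
  by rewrite -normsq_complexify realifyK sqr_normc.
by split=> [[]|->].
Qed.

Lemma coord_realify z j : z 0 j = 0 <-> sqmod j (realify z) = 0.
Proof.
have e : (z 0 j == 0) = (sqmod j (realify z) == 0).
  by rewrite -normsq_complexify_coord realifyK normsq_eq0.
by split=> /eqP; rewrite ?e => /eqP//; move=> /eqP; rewrite -e => /eqP.
Qed.

Lemma smooth_on_complexify (r : R) (A : set 'rV[R[i]]_n) (f : 'rV[R]_(n + n) -> 'rV[R]_(n + n)) :
  A `<=` sphere r -> smooth_near (real_sphere r) f ->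
  smooth_on A (fun z => complexify (f (realify z))).
Proof.
move=> AS [U [oU SU cf]] z Az; exists U, f; split=> //.
  by apply/SU/sphere_realify/AS.
by move=> w _ _; rewrite complexifyK.
Qed.

Lemma link_equiv_diffeomorphism (r : R) H1 H2 : link_equiv r H1 H2 ->
  exists psi : 'rV[R[i]]_n -> 'rV[R[i]]_n,
    diffeomorphism_of_pairs (sphere r) (link r H1) (sphere r) (link r H2) psi /\
    forall I : {set 'I_n},
       diffeomorphism_of_pairs (coord_sphere r I) (coord_link r I H1)
         (coord_sphere r I) (coord_link r I H2) psi.
Proof.
move=> [f [g [[cf cg] fS gS f0 fH]]].
pose psi z := complexify (f (realify z)); pose phi z := complexify (g (realify z)).
have psiS z : sphere r z -> sphere r (psi z) /\ phi (psi z) = z.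
  move=> /sphere_realify/fS[Sf fK]; split.
    by apply/sphere_realify; rewrite complexifyK.
  by rewrite /phi complexifyK fK realifyK.
have phiS z : sphere r z -> sphere r (phi z) /\ psi (phi z) = z.
  move=> /sphere_realify/gS[Sg gK]; split.
    by apply/sphere_realify; rewrite complexifyK.
  by rewrite /psi complexifyK gK realifyK.
have psi0 z j : sphere r z -> z 0 j = 0 <-> psi z 0 j = 0.
  move=> /sphere_realify Sz; apply: (iff_trans (coord_realify z j)).
  apply: (iff_trans (f0 j _ Sz)); apply: iff_sym.
  by apply: (iff_trans (coord_realify _ j)); rewrite complexifyK.
have psiH z : sphere r z -> H1 z = 0 <-> H2 (psi z) = 0.
  by move=> /sphere_realify /fH; rewrite realifyK.
(* P holds everywhere for the sphere itself, and on C^I for its subspheres *)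
have main (P : 'rV[R[i]]_n -> Prop) :
    (forall z, sphere r z -> P z <-> P (psi z)) ->
    diffeomorphism_of_pairs (sphere r `&` P) (H1 @^-1` [set 0] `&` (sphere r `&` P))
      (sphere r `&` P) (H2 @^-1` [set 0] `&` (sphere r `&` P)) psi.
  move=> psiP.
  have phiP z : sphere r z -> P z -> P (phi z).
    by move=> Sz Pz; have [Sp pK] := phiS z Sz; apply/(psiP _ Sp); rewrite pK.
  split; first split.
  - by apply: smooth_on_complexify cf => z [].
  - exists phi; split.
    + by apply: smooth_on_complexify cg => z [].
    + by move=> z [Sz Pz]; split; [have [] := psiS z Sz|exact: (psiP z Sz).1].
    + by move=> z [Sz Pz]; split; [have [] := phiS z Sz|exact: phiP].
    + by move=> z /set_mem[Sz _]; have [] := psiS z Sz.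
    + by move=> z /set_mem[Sz _]; have [] := phiS z Sz.
  - apply/seteqP; split=> [_ [z [Hz [Sz Pz]] <-]|w [Hw [Sw Pw]]].
      have [Sp _] := psiS z Sz; split; first exact: (psiH z Sz).1.
      by split=> //; exact: (psiP z Sz).1.
    have [Sp pK] := phiS w Sw; exists (phi w) => //; split.
      by apply/(psiH _ Sp); rewrite pK.
    by split=> //; exact: phiP.
exists psi; split.
  have := main setT (fun _ _ => iff_refl _).
  by rewrite setIT.
move=> I; apply: main => z Sz; split=> H j jI.
  by apply/(psi0 z j Sz)/H.
by apply/(psi0 z j Sz)/H.
Qed.

End Assembly.

Theorem theorem2p24 (R : realType) (n k : nat) (hk : (1 <= k)%N)
    (hkn : (k < n)%N) (Lam : 'M[R[i]]_(k, n)) (a b : 'I_n -> nat)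
    (ha : forall j, (0 < a j)%N) (hLam : all_maximal_minors_nonzero Lam)
    (r t : R) (hr : 0 < r) (ht0 : 0 <= t) (ht1 : t <= 1) :
  exists psi : 'rV[R[i]]_n -> 'rV[R[i]]_n,
    diffeomorphism_of_pairs
      (sphere r) (link r (hamm_deformation Lam a b t))
      (sphere r) (link r (hamm Lam a)) psi /\
    (forall I : {set 'I_n}, (k < #|I|)%N ->
       diffeomorphism_of_pairs
         (coord_sphere r I) (coord_link r I (hamm_deformation Lam a b t))
         (coord_sphere r I) (coord_link r I (hamm Lam a)) psi).
Proof.
have equiv : link_equiv r (hamm_deformation Lam a b t) (hamm Lam a).
  move: ht0; rewrite le_eqVlt => /predU1P[<-|t0]; last exact: hamm_deformation_equiv.
  have [e [e0 e1 He]] := deformation_near_zero b ha (ltnW hkn) hLam hr.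
  exact: link_equiv_trans (link_equiv_sym He) (hamm_deformation_equiv _ _ ha hr e0 e1).
have [psi [psiK psiI]] := link_equiv_diffeomorphism equiv.
by exists psi; split=> // I _; exact: psiI.
Qed.
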